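(* Let $T=T(D)$ be a perfect binary tree of diameter $D$, and let $\xi_0\in\{-1,1\}^{V(T)}$ be chosen uniformly at random. There exist constants $c_->1/4$ and $c_+<1/3$ such that with probability tending to $1$ as $D\to\infty$, $$c_-\cdot D<\tau(T;\xi_0)<c_+\cdot D.$$
   Context: A rooted tree is $k$-ary if every non-leaf vertex (including the root) has exactly $k+1$ neighbours; so the root has $k+1$ children and every other non-leaf vertex has $k$ children. It is perfect if all leaves are at the same distance from the root. A perfect binary tree is a perfect $2$-ary tree (so the root has degree $3$). Majority dynamics on a graph $G$ with all degrees odd: given $\xi_0\in\{-1,1\}^{V(G)}$, for $t\ge1$, $\xi_t(i)=\mathrm{sign}\sum_{j\in N_G(i)}\xi_{t-1}(j)$. The stabilisation time is $\tau(G;\xi_0)=\min\{t\ge0:\ \xi_{t+2}(i)=\xi_t(i)\text{ for all } i\in V(G)\}$. *)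

(* Defs.v *)
From mathcomp Require Import all_boot all_order all_algebra.
From mathcomp Require Import boolp reals.

Set Implicit Arguments.
Unset Strict Implicit.
Unset Printing Implicit Defensive.

Import Order.TTheory GRing.Theory Num.Theory.
Local Open Scope ring_scope.

Definition simple_graph (V : finType) (e : rel V) : Prop :=
  symmetric e /\ irreflexive e.

(* In a symmetric relation every edge is a [ucycle] of size 2, hence the bound
   on the size. *)
Definition acyclic (V : finType) (e : rel V) : Prop :=
  forall c : seq V, (2 < size c)%N -> ~ ucycle e c.

Definition tree (V : finType) (e : rel V) : Prop :=
  [/\ simple_graph e, forall x y, connect e x y & acyclic e].

Definition degree (V : finType) (e : rel V) (x : V) : nat :=
  #|[set y | e x y]|.

Definition leaf (V : finType) (e : rel V) (x : V) : bool := degree e x == 1%N.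

Definition walk (V : finType) (e : rel V) (n : nat) (x y : V) : bool :=
  [exists p : n.-tuple V, path e x p && (last x p == y)].

(* The least length of a walk from x to y. A shortest walk has fewer than #|V|
   edges; the value is #|V| when y cannot be reached from x. *)
Definition dist (V : finType) (e : rel V) (x y : V) : nat :=
  find (fun n => walk e n x y) (iota 0 #|V|).

Definition diameter (V : finType) (e : rel V) : nat :=
  (\max_(x : V) \max_(y : V) dist e x y)%N.

Definition kary_tree (k : nat) (V : finType) (e : rel V) : Prop :=
  tree e /\ forall x, ~~ leaf e x -> degree e x = k.+1.

(* With k > 0 the root r is never a leaf here: it would be a leaf at distance 0
   from itself, and the tree would have another leaf. *)
Definition perfect_kary_tree (k : nat) (V : finType) (e : rel V) (r : V) : Prop :=
  kary_tree k e /\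
  forall x y, leaf e x -> leaf e y -> dist e r x = dist e r y.

Definition perfect_binary_tree (V : finType) (e : rel V) (r : V) : Prop :=
  perfect_kary_tree 2 e r.

(* {ffun V -> bool} encodes {-1, 1}^V. *)
Definition spins (V : finType) (x : {ffun V -> bool}) : {ffun V -> int} :=
  [ffun i => if x i then 1 else -1].

Definition majority_step (V : finType) (e : rel V) (xi : {ffun V -> int}) :
    {ffun V -> int} :=
  [ffun i => Num.sg (\sum_(j | e i j) xi j)].

Definition majority (V : finType) (e : rel V) (xi0 : {ffun V -> int})
    (t : nat) : {ffun V -> int} :=
  iter t (majority_step e) xi0.

Definition stabilised (V : finType) (e : rel V) (xi0 : {ffun V -> int})
    (t : nat) : bool :=
  [forall i, majority e xi0 t.+2 i == majority e xi0 t i].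

(* The least t with [stabilised e xi0 t]; the junk value 0 is returned if there
   is none, which does not happen when xi0 takes values in {-1, 1} and all
   degrees are odd (majority dynamics on a finite graph is eventually
   2-periodic). *)
Definition stabilisation_time (V : finType) (e : rel V)
    (xi0 : {ffun V -> int}) : nat :=
  if pselect (exists t, stabilised e xi0 t) is left ex then ex_minn ex else 0%N.

Definition uniform_prob (R : realType) (T : finType) (A : {set T}) : R :=
  #|A|%:R / #|T|%:R.
Arguments uniform_prob R {T} A.

(* Main.v *)
Require Import Defs.
From mathcomp Require Import all_boot all_order all_algebra.
From mathcomp Require Import boolp reals.
From mathcomp Require Import zify ring lra.

(** A tree of diameter [D = 2 H] has about [2^H] vertices and
    [2^(H + n/2)] paths of length [n].

    Upper bound. If a vertex flips from - to + at time [T], then one of its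
    neighbours flips from - to + at time [T - 1]; the vertex that flips next was
    still - at that moment, so the trace never turns back. It is a simple path
    [u_2, ..., u_T] such that [u_s] flips at time [s], and the neighbour [o_s] of
    [u_s] off the path is + at time [s - 1]. The subtrees hanging off the path
    are independent. At most sites [u_s] has been - all along ("clean") and [o_s]
    reaches + although its parent is -; otherwise [o_s] is "bad", i.e. turns from
    - to + under a parent in state -, up to rare sites with bad neighbours. A
    transfer-matrix estimate bounds the probability of a given path by
    [(97/400)^n], and [97/400 < 1/4] leads to [c_+ < 1/3].

    Lower bound. A front climbs a path whose vertices are all - and whose
    off-path neighbours are all +, turns at the apex and goes down another such
    path. The two choices of the path at each vertex are mutually exclusive, so
    the probability of such a front can be computed by a recursion, and the
    product [q_A q_B] of the probabilities that an off-path subtree is + in spite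
    of a parent in state - exceeds [1/16], which leads to [c_- > 1/4].

    On a bipartite graph the dynamics splits into two independent classes of
    space-time points; type A (resp. B) refers to a vertex observed at even
    (resp. odd) times. *)

Set Implicit Arguments.
Unset Strict Implicit.
Unset Printing Implicit Defensive.

Import Order.TTheory GRing.Theory Num.Theory.

(** * Dynamics of a subtree driven by its parent *)

(* lia would case split on every boolean hypothesis. *)
Ltac plia :=
  repeat match goal with
  | H : is_true (~~ ?b) |- _ =>
    lazymatch b with odd _ => fail | leq _ _ => fail | _ => clear H end
  | H : is_true ?b |- _ =>
    lazymatch b with
    | leq _ _ => fail | odd _ => fail | ~~ _ => fail | andb _ _ => fail
    | eq_op _ _ => fail | _ => clear H end
  | H : @eq bool ?b _ |- _ => lazymatch b with odd _ => fail | _ => clear H end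
  | H : forall _, _ |- _ => clear H
  end; lia.

(** The obstacle in the upper bound is dependence: an off-path subtree is driven by the path. The
    site events are therefore existential over all inputs, which makes them properties of disjoint
    subtrees, hence independent. The price is that [CanEv], all that is guaranteed at an unclean
    site, is only bounded by 5/8, far too much per site. Two lemmas on adjacent sites show that the
    next site is then bad, an event of probability at most 1/24, and the automaton [know] keeps
    track of this. If all sites were clean, two consecutive ones would cost at most (11/80)
    (641/2000), well below 1/16; the other transitions use up most of this room.

    The thresholds come from counting. A rate of 1/4 against 2^(H + n/2) paths balances at n = 2H/3
    = D/3. A front that climbs and descends n levels has about 2^(H - n) disjoint places and, if q_A
    q_B were 1/16, probability about 8^(-n); this balances at n = H/4, that is at time 2n = D/4. Any
    strict gain in either rate moves the constant strictly past its threshold, so rational bounds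
    with little room are enough. *)

Definition maj (a b c : bool) : bool := (a && b) || (c && (a || b)).

(** The subtree below a vertex. The parent is not part of it and enters the dynamics only as an
    input trajectory [z]; a leaf has no other neighbour and copies it. *)
Inductive tr := Lf of bool | Nd of bool & tr & tr.

Definition root (t : tr) : bool := match t with Lf b => b | Nd b _ _ => b end.

Fixpoint step (t : tr) (z : bool) : tr :=
  match t with
  | Lf _ => Lf z
  | Nd b l r => Nd (maj z (root l) (root r)) (step l b) (step r b)
  end.

Fixpoint state (t : tr) (z : nat -> bool) (n : nat) : tr :=
  if n is m.+1 then step (state t z m) (z m) else t.

Definition out (t : tr) (z : nat -> bool) (n : nat) : bool := root (state t z n).

Lemma state_Lf b z n : state (Lf b) z n = Lf (out (Lf b) z n).
Proof. by elim: n => //= n; rewrite /out /= => ->. Qed.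

Lemma state_Nd b l r z n (w := out (Nd b l r) z) :
  state (Nd b l r) z n = Nd (w n) (state l w n) (state r w n).
Proof. by elim: n => //= n IH; rewrite {1}IH /= /w /out /= -/w IH. Qed.

Lemma outS_Lf b z n : out (Lf b) z n.+1 = z n.
Proof. by rewrite /out /= state_Lf. Qed.

Lemma outS_Nd b l r z n (w := out (Nd b l r) z) :
  w n.+1 = maj (z n) (out l w n) (out r w n).
Proof. by rewrite {1}/w /out /= state_Nd. Qed.

Lemma maj_mono (a b c a' b' c' : bool) :
  (a -> a') -> (b -> b') -> (c -> c') -> maj a b c -> maj a' b' c'.
Proof.
by move: a b c a' b' c' => [] [] [] [] [] [] //= A B C _;
   do ?[by have := A isT | by have := B isT | by have := C isT].
Qed.

(* The value at time n only depends on the inputs at earlier times of the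
   opposite parity: the two parity classes of the dynamics do not interact. *)
Lemma out_mono t (z z' : nat -> bool) n :
  (forall m, m < n -> odd (m + n) -> z m -> z' m) -> out t z n -> out t z' n.
Proof.
elim/ltn_ind: n t z z' => -[//|n] IH t z z' H.
case: t => [b|b l r]; first by rewrite !outS_Lf; apply: H; lia.
rewrite !outS_Nd; set w := out _ z; set w' := out _ z'.
have ww' m : m < n -> odd (m + n) -> w m -> w' m.
  move=> mn o; apply: IH; first by lia.
  by move=> m' lt o'; apply: H; lia.
apply: maj_mono; first (by apply: H; lia); by apply: IH.
Qed.

Lemma out_eq t (z z' : nat -> bool) n :
  (forall m, m < n -> odd (m + n) -> z m = z' m) -> out t z n = out t z' n.
Proof. by move=> H; apply/idP/idP; apply: out_mono => m lt o; rewrite H. Qed.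

Fixpoint neg (t : tr) : tr :=
  match t with Lf b => Lf (~~ b) | Nd b l r => Nd (~~ b) (neg l) (neg r) end.

Lemma maj_neg a b c : maj (~~ a) (~~ b) (~~ c) = ~~ maj a b c.
Proof. by case: a b c => [] [] []. Qed.

Lemma root_neg t : root (neg t) = ~~ root t. Proof. by case: t. Qed.

Lemma step_neg t z : step (neg t) (~~ z) = neg (step t z).
Proof. by elim: t z => //= b l IHl r IHr z; rewrite !root_neg maj_neg IHl IHr. Qed.

Lemma state_neg t z n : state (neg t) (fun m => ~~ z m) n = neg (state t z n).
Proof. by elim: n => //= n ->; rewrite step_neg. Qed.

Lemma out_neg t z n : out (neg t) (fun m => ~~ z m) n = ~~ out t z n.
Proof. by rewrite /out state_neg root_neg. Qed.

Definition child (d : bool) (t : tr) : tr :=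
  match t with Lf b => Lf b | Nd _ l r => if d then r else l end.

Definition isNd (t : tr) : bool := if t is Nd _ _ _ then true else false.

Lemma outS_child d t z n (w := out t z) : isNd t ->
  w n.+1 = maj (z n) (out (child d t) w n) (out (child (~~ d) t) w n).
Proof.
rewrite /w; case: t {w} => // b l r _; rewrite outS_Nd.
by case: d => //=; rewrite /maj; case: (z n) (out l _ n) (out r _ n) => [] [] [].
Qed.

Lemma majC a b c : maj a b c = maj b a c.
Proof. by case: a b c => [] [] []. Qed.

(* A site is a vertex of the causal path together with its neighbour off the
   path; u and o are their trajectories and the site flips from - to + between
   the times i and i + 2. *)
Definition clean (u : nat -> bool) (i : nat) : Prop :=
  forall t, t <= i -> ~~ odd (t + i) -> ~~ u t.

Definition bad (u o : nat -> bool) (i : nat) : Prop :=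
  exists s, [/\ odd (s + i), ~~ o s, o s.+2 & ~~ u s.+1].

(** Between [t] and [i + 1] the trajectory [o] must pass from - to +, and at each moment where it
    can do so [u] is -. *)
Lemma late_change_bad (u o : nat -> bool) i t :
  t <= i -> odd (t + i) -> ~~ o t -> o i.+1 ->
  (forall s, t < s -> s <= i -> ~~ odd (s + i) -> ~~ u s) -> bad u o i.
Proof.
move: {2}(i - t)%N (leqnn (i - t)) => n.
elim: n t => [|n IH] t tn ti od not oi H; first plia.
have ut : ~~ u t.+1 by apply: H; plia.
case E: (o t.+2); first by exists t.
apply: (IH t.+2) => //; try by rewrite ?E.
- by plia.
- case: (leqP t.+2 i) => // ?; have Ei : t.+1 = i by plia.
  by move: oi; rewrite -Ei E.
- by plia.
- by move=> s st; apply: H; plia.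
Qed.

Lemma not_clean (u : nat -> bool) i : ~ clean u i -> exists t, [/\ t <= i, ~~ odd (t + i) & u t].
Proof.
move=> H; apply: contrapT => H'; apply: H => t ti od; apply/negP => ut.
by apply: H'; exists t.
Qed.

Lemma last_plus (u : nat -> bool) i t : t <= i -> ~~ odd (t + i) -> u t -> ~~ u i ->
  exists t', [/\ t <= t', t'.+2 <= i, ~~ odd (t' + i), u t' &
    forall s, t' < s -> s <= i -> ~~ odd (s + i) -> ~~ u s].
Proof.
move: {2}(i - t)%N (leqnn (i - t)) => n.
elim: n t => [|n IH] t tn ti od ut ui.
  have E : t = i by plia.
  by move: ui; rewrite -E ut.
case: (pselect (exists t', [/\ t < t', t' <= i, ~~ odd (t' + i) & u t'])).
  move=> [t1 [lt1 le1 od1 ut1]].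
  have tn1 : i - t1 <= n by plia.
  have [t' [? ? ? ? ?]] := IH t1 tn1 le1 od1 ut1 ui.
  by exists t'; split => //; plia.
move=> H; exists t; split => //.
- case: (ltngtP t i) => [|//|E]; [plia|plia|by move: ui; rewrite -E ut].
- by move=> s ts si os; apply/negP => us; apply: H; exists s.
Qed.

(** * Consecutive sites of a causal path *)

Section AdjacentSites.

Variables (u u' o o' y y' : nat -> bool) (i i' : nat).
Hypothesis adj : i' = i.+1 \/ i = i'.+1.
Hypothesis dyn : forall t, u t.+1 = maj (u' t) (y t) (o t).
Hypothesis dyn' : forall t, u' t.+1 = maj (u t) (y' t) (o' t).
Hypotheses (ui : ~~ u i) (ui' : ~~ u' i') (oi : o i.+1) (oi' : o' i'.+1).

(** If [u'] is + at time [t], then [u], being - at [t + 1], forces [o] to be - at [t]. Since [o]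
    ends in +, it changes while [u] is still -. *)
Lemma clean_next_to_unclean : clean u i -> ~ clean u' i' -> bad u o i.
Proof.
move=> cl /not_clean [t0 [le0 od0 ut0]].
have [t [_ le od ut _]] := last_plus le0 od0 ut0 ui'.
apply: (@late_change_bad _ _ _ t) => //.
- by case: adj; plia.
- by case: adj; plia.
- have : ~~ u t.+1 by apply: cl; case: adj; plia.
  by rewrite dyn ut /maj; case: (y t) (o t) => [] [].
- by move=> s _ le' od'; apply: cl.
Qed.

(** Let [t] be the last time at which [u] is +. Then [o] is + at [t + 1], since otherwise it would
    change late and be bad. As [u] is - at [t + 2], this forces [u'] to be - at [t + 1], which in
    turn forces [o'] to be - at [t]; it remains to find a late change of [o']. *)
Lemma unclean_not_bad : ~ clean u i -> ~ bad u o i -> bad u' o' i'.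
Proof.
move=> /not_clean [t0 [le0 od0 ut0]] nb.
have [t [_ le od ut Ht]] := last_plus le0 od0 ut0 ui.
have ot : o t.+1.
  apply/negP => /negP ot; apply: nb; apply: (late_change_bad _ _ ot oi); try plia.
  by move=> s ts si os; apply: Ht => //; plia.
have u2 : ~~ u t.+2 by apply: Ht; plia.
have u't : ~~ u' t.+1.
  by move: u2; rewrite dyn ot /maj; case: (u' t.+1) (y t.+1) => [] [].
have o't : ~~ o' t.
  by move: u't; rewrite dyn' ut /maj; case: (y' t) (o' t) => [] [].
(* If [u'] is + again after [t], its last such time [s] gives a late change of [o'] when [o'] is -
   at [s + 1]; otherwise the same forcing argument, with the roles exchanged, gives a late change of
   [o], which is excluded. *)
case: (pselect (exists s, [/\ t < s, s <= i', ~~ odd (s + i') & u' s])); last first.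
  move=> H; apply: (late_change_bad _ _ o't oi'); [case: adj; plia..|].
  by move=> s ts si os; apply/negP => us; apply: H; exists s.
move=> [s0 [ts0 si0 os0 us0]].
have [s [les lesi ods us Hs]] := last_plus si0 os0 us0 ui'.
case o's : (o' s.+1); last first.
  apply: (late_change_bad _ _ (negbT o's) oi'); [plia..|].
  by move=> r rs ri ro; apply: Hs => //; plia.
have u's : ~~ u' s.+2 by apply: Hs; plia.
have us1 : ~~ u s.+1.
  by move: u's; rewrite dyn' o's /maj; case: (u s.+1) (y' s.+1) => [] [].
have os : ~~ o s.
  by move: us1; rewrite dyn us /maj; case: (y s) (o s) => [] [].
case: nb; apply: (late_change_bad _ _ os oi); [case: adj; plia..|].
by move=> r rs ri ro; apply: Ht => //; plia.
Qed.

End AdjacentSites.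

(** * Tracing a flip back along a path *)

(* The boolean p is the parity of the times at which the root is observed. *)
Definition QEv (p : bool) (t : tr) : Prop :=
  exists n, [/\ 0 < n, odd n = p & out t (fun=> false) n].

(** The input is quantified existentially, here and in [CanEv], so that the event depends on the
    initial states of the subtree alone. *)
Definition BadEv (p : bool) (t : tr) : Prop :=
  exists z n, [/\ odd n = p, ~~ out t z n, out t z n.+2 & ~~ z n.+1].

Definition CanEv (p : bool) (t : tr) : Prop :=
  exists z n, [/\ odd n.+1 = p, ~~ z n & out t z n.+1].

(** Here [b] is the initial state of the path vertex and [t] the off-path subtree. For an even flip
    time ([p] false) time 0 is in the observed parity class, so a clean vertex starts in -; this is
    a factor 1/2 at every other site. *)
Definition CleanEv (p : bool) (b : bool) (t : tr) : Prop :=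
  (p \/ ~~ b) /\ QEv (~~ p) t.

(* What is known of the next site: it is clean (KN), not clean (KE), bad (KP),
   or nothing is known (KB). *)
Inductive know := KN | KE | KB | KP.

Definition may_clean (s : know) : bool :=
  match s with KN | KB => true | _ => false end.
Definition may_can (s : know) : bool :=
  match s with KE | KB => true | _ => false end.
Definition after_bad (s : know) : know := if s is KN then KE else KB.

(** Each alternative charges one event to the off-path subtree and records what the lemmas on
    adjacent sites imply for the next site. The existential over [d] covers all descending paths of
    [n] sites at once. *)
Fixpoint Chain (n : nat) (s : know) (p : bool) (t : tr) : Prop :=
  if n is m.+1 then
    match t with
    | Lf _ => False
    | Nd b l r => exists d : bool,
        let c := if d then r else l in
        let off := if d then l else r in
        [\/ [/\ may_clean s, CleanEv p b off & Chain m KN (~~ p) c],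
            BadEv (~~ p) off /\ Chain m (after_bad s) (~~ p) c |
            [/\ may_can s, CanEv (~~ p) off & Chain m KP (~~ p) c]]
    end
  else True.

(* A descending path of consecutive sites, given by the directions and by the
   times at which the sites flip. *)
Fixpoint Seg (ds : seq (bool * nat)) (t : tr) (z : nat -> bool) : Prop :=
  if ds is (d, i) :: ds' then
    [/\ isNd t, ~~ out t z i, out (child (~~ d) t) (out t z) i.+1,
        (if ds' is (_, i') :: _ then i' = i.+1 \/ i = i'.+1 else True) &
        Seg ds' (child d t) (out t z)]
  else True.

Definition known (s : know) (t : tr) (z : nat -> bool) (d : bool) (i : nat) :=
  let u := out t z in
  match s with
  | KN => clean u i
  | KE => ~ clean u i
  | KB => True
  | KP => bad u (out (child (~~ d) t) u) i
  end.

Lemma Seg_Chain ds d i t z s :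
  Seg ((d, i) :: ds) t z -> known s t z d i ->
  Chain (size ds).+1 s (odd i) t.
Proof.
elim: ds d i t z s => [|[d' i'] ds IH] d i t z s [nd ui oi adj seg] kn.
  case: t nd ui oi kn {adj seg} => // b l r _ ui oi kn.
  exists d; set off := if d then l else r.
  have Eoff : child (~~ d) (Nd b l r) = off by rewrite /off; case: d {oi kn off}.
  rewrite Eoff in oi.
  have can : CanEv (~~ odd i) off by exists (out (Nd b l r) z), i.
  have cln : clean (out (Nd b l r) z) i -> CleanEv (odd i) b off.
    move=> cl; split.
      case od: (odd i); [by left | right].
      by apply: (cl 0) => //; rewrite add0n od.
    exists i.+1; split => //.
    rewrite -(@out_eq _ (out (Nd b l r) z)) // => m mi om.
    by apply/negbTE/cl; plia.
  have bd : bad (out (Nd b l r) z) (out off (out (Nd b l r) z)) i ->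
      BadEv (~~ odd i) off.
    move=> [n [on o1 o2 u1]]; exists (out (Nd b l r) z), n; split => //.
    by plia.
  case: s kn => /=.
  - by move=> /cln; constructor 1.
  - by constructor 3.
  - by move=> _; constructor 3.
  - by move=> H; constructor 2; split => //; apply: bd; rewrite -Eoff.
have [nd' ui' oi' adj' seg'] := seg.
case: t nd ui oi kn seg nd' ui' oi' adj' seg' => // b l r _ ui oi kn seg nd' ui' oi' adj' seg'.
exists d; set off := if d then l else r; set c := if d then r else l.
have Eoff : child (~~ d) (Nd b l r) = off by rewrite /off; case: d {oi kn seg nd' ui' oi' adj' seg' off c}.
have Ec : child d (Nd b l r) = c by [].
rewrite ?Eoff ?Ec in oi kn seg nd' ui' oi' adj' seg'.
set u := out (Nd b l r) z in ui oi kn seg nd' ui' oi' adj' seg'.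
set u' := out c u in ui' oi' seg' *.
have can : CanEv (~~ odd i) off by exists u, i.
have cln : clean u i -> CleanEv (odd i) b off.
  move=> cl; split.
    case od: (odd i); [by left | right].
    by apply: (cl 0) => //; rewrite add0n od.
  exists i.+1; split => //.
  rewrite -(@out_eq _ u) // => m mi om.
  by apply/negbTE/cl; plia.
have bd : bad u (out off u) i -> BadEv (~~ odd i) off.
  move=> [n [on o1 o2 u1]]; exists u, n; split => //.
  by plia.
have nxt s' : known s' c u d' i' -> Chain (size ds).+1 s' (~~ odd i) c.
  move=> kn'; have -> : ~~ odd i = odd i' by case: adj => ->; rewrite /= ?negbK.
  exact: (IH d' i' c u s' seg kn').
have D1 n : u n.+1 = maj (u' n) (z n) (out off u n).
  by rewrite {1}/u (outS_child d) // Ec Eoff -/u -/u' majC.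
have D2 n : u' n.+1 =
    maj (u n) (out (child d' c) u' n) (out (child (~~ d') c) u' n).
  by rewrite {1}/u' (outS_child d' _ _ nd').
(* When [o] is not bad, a clean site is followed by a clean one ([F1]) and an unclean site by a bad
   one ([F2]). The cases below read off the transitions. *)
have F1 := clean_next_to_unclean adj D1 ui' oi.
have F2 := unclean_not_bad adj D1 D2 ui ui' oi oi'.
case: s kn => /=.
- move=> cl; case: (pselect (clean u' i')) => cl'.
    by constructor 1; split; [|exact: cln|exact: (nxt KN)].
  by constructor 2; split; [exact/bd/F1|exact: (nxt KE)].
- move=> ncl; case: (pselect (bad u (out off u) i)) => bdu.
    by constructor 2; split; [exact/bd|exact: (nxt KB)].
  by constructor 3; split => //; apply: (nxt KP); exact: F2.
- move=> _; case: (pselect (bad u (out off u) i)) => bdu.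
    by constructor 2; split; [exact/bd|exact: (nxt KB)].
  case: (pselect (clean u i)) => cl.
    constructor 1; split => //; first exact: cln.
    by apply: (nxt KN); apply: contrapT => ncl; apply: bdu; exact: F1.
  by constructor 3; split => //; apply: (nxt KP); exact: F2.
- move=> bdu; constructor 2; split; [apply: bd|exact: (nxt KB)].
  by rewrite -Eoff.
Qed.

Lemma Seg_take n ds t z : Seg ds t z -> Seg (take n ds) t z.
Proof.
elim: ds n t z => [|[d i] ds IH] [|n] t z //= [nd ui oi adj seg].
by split => //; [case: ds adj {IH seg} => [|[? ?] ?] //; case: n|exact: IH].
Qed.

Lemma Seg_Chain_KB n ds t z : Seg ds t z -> n <= size ds ->
  exists p, Chain n KB p t.
Proof.
move=> seg le; have := Seg_take n seg.
case E: (take n ds) => [|[d i] ds'].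
  by have := size_takel le; rewrite E => <-; exists true.
move=> /Seg_Chain H; exists (odd i).
by have := size_takel le; rewrite E => <-; exact: H.
Qed.

Fixpoint perf (k : nat) (t : tr) : Prop :=
  match k, t with
  | 0, Lf _ => True
  | j.+1, Nd _ l r => perf j l /\ perf j r
  | _, _ => False
  end.

Lemma Seg_perf ds t z k : Seg ds t z -> perf k t -> size ds <= k.
Proof.
elim: ds t z k => [|[d i] ds IH] t z k //= [].
case: t => // b l r _ _ _ _ seg; case: k => // k [pl pr]; rewrite ltnS.
by apply: (IH _ _ _ seg); case: d {seg}.
Qed.

(** * From a flip to two descending chains *)

Definition flip (u : nat -> bool) (i : nat) : Prop := ~~ u i /\ u i.+2.

(** With the parent in - at [i + 1], both children are + at that time, while at least one of them is
    - at [i - 1] because the vertex is - at [i]. That child flips one step earlier, again under a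
    parent in -, and the descent ends at time 0. *)
Lemma up_chain i t z : flip (out t z) i -> ~~ z i.+1 ->
  exists d ds, size ds = i /\ Seg ((d, i) :: ds) t z.
Proof.
elim: i t z => [|i IH] [b|b l r] z [u0 u2] zi;
  do ?[by move: u2; rewrite outS_Lf (negbTE zi)].
  exists true, [::]; split=> //=; split => //.
  move: u2; rewrite outS_Nd (negbTE zi) /maj /=.
  by case: (out l _ 1); case: (out r _ 1).
set u := out _ z in u0 u2.
have [l3 r3] : out l u i.+2 /\ out r u i.+2.
  move: u2; rewrite {1}/u outS_Nd -/u (negbTE zi) /maj /=.
  by case: (out l _ _); case: (out r _ _).
have [d cd] : exists d, ~~ out (child d (Nd b l r)) u i.
  move: u0; rewrite {1}/u outS_Nd -/u /maj.
  case El: (out l u i); last by exists false; rewrite /= El.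
  case Er: (out r u i); last by exists true; rewrite /= Er.
  by rewrite orbT andbT; case: (z i).
have fl : flip (out (child d (Nd b l r)) u) i by split => //; case: d {cd}.
have [d' [ds [sz seg]]] := IH _ u fl u0.
exists d, ((d', i) :: ds); split; first by rewrite /= sz.
by split => //; [case: d {cd fl seg} | right].
Qed.

(** The two legs of a trace below a common parent. Every off-path subtree of a leg keeps height at
    least 2, because the probability bounds fail below that height; cutting two sites off each
    segment accounts for the 4 in [Segs_Apex]. *)
Definition Apex (N k : nat) (l r : tr) : Prop :=
  exists na nc pa pc,
    [/\ na + nc = N, na.+2 <= k, nc.+2 <= k, Chain na KB pa l & Chain nc KB pc r].

Fixpoint HasApex (N k : nat) (t : tr) : Prop :=
  match k, t with
  | j.+1, Nd _ l r => [\/ Apex N j l r, HasApex N j l | HasApex N j r]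
  | _, _ => False
  end.

Lemma Apex_sym N k l r : Apex N k l r -> Apex N k r l.
Proof.
by move=> [na [nc [pa [pc [H1 H2 H3 H4 H5]]]]]; exists nc, na, pc, pa; split => //; plia.
Qed.

Lemma Segs_Apex N k l r dl dr zl zr : 0 < N -> perf k l -> perf k r ->
  Seg dl l zl -> Seg dr r zr -> N + 4 <= size dl + size dr -> Apex N k l r.
Proof.
move=> N0 pl pr sl sr le.
have hl := Seg_perf sl pl; have hr := Seg_perf sr pr.
pose na := minn N (size dl - 2); pose nc := (N - na)%N.
have [pa Ca] : exists p, Chain na KB p l by apply: (Seg_Chain_KB sl); rewrite /na; lia.
have [pc Cc] : exists p, Chain nc KB p r by apply: (Seg_Chain_KB sr); rewrite /nc /na; lia.
by exists na, nc, pa, pc; split => //; rewrite /nc /na; lia.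
Qed.

Fixpoint flips (i : nat) (t : tr) (z : nat -> bool) : Prop :=
  flip (out t z) i \/
  match t with
  | Lf _ => False
  | Nd b l r => flips i l (out t z) \/ flips i r (out t z)
  end.

(** The part of the trace already followed, read downwards from the vertex it has reached at time
    [i]. *)
Definition down (m i : nat) (t : tr) (z : nat -> bool) : Prop :=
  flip (out t z) i /\
  exists ds, [/\ size ds = m, Seg ds t z & if ds is (_, i') :: _ then i' = i else True].

Lemma maj_flip a b c a' b' c' : ~~ maj a b c -> maj a' b' c' ->
  [\/ ~~ a /\ a', ~~ b /\ b' | ~~ c /\ c'].
Proof.
by case: a b c a' b' c' => [] [] [] [] [] [] //= _ _;
  do ?[by constructor 1 | by constructor 2 | by constructor 3].
Qed.

Lemma child_flip_Apex N k i c o z : 0 < N -> perf k c -> perf k o ->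
  flip (out c z) i -> ~~ z i.+1 -> N + 3 <= i -> Apex N k c o.
Proof.
move=> N0 pc po fl zi le; have [d [ds [sz seg]]] := up_chain fl zi.
by apply: (Segs_Apex N0 pc po seg (I : Seg [::] o z)); rewrite /= sz; lia.
Qed.

(** Since [c] is still - at time [i], the vertex [u] becomes + through [o] and its parent. If [o]
    has just flipped, its own chain and the segment in [c] form an apex; otherwise the parent has
    just flipped and the trace continues upwards. If time 0 is reached, the segment in [c] is long
    enough on its own. *)
Lemma trace_step N k m i c o (u z : nat -> bool) :
  0 < N -> perf k c -> perf k o -> N + 5 <= i + m ->
  (forall n, u n.+1 = maj (z n) (out c u n) (out o u n)) ->
  down m i c u -> 0 < i -> ~~ u i.-1 -> u i.+1 ->
  Apex N k c o \/ [/\ 1 < i, out o u i, ~~ z i.-2 & z i].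
Proof.
move=> N0 pc po le dyn [[ci ci2] [ds [sz seg hd]]]; case: i => // i in le ci ci2 hd *.
move=> _ /= ui ui2.
have [zi oi] : z i.+1 /\ out o u i.+1.
  by move: ui2; rewrite dyn (negbTE ci) /maj; case: (z _); case: (out o u _).
case: i => [|i] in le ci ci2 hd ui ui2 zi oi *.
  by left; apply: (Segs_Apex N0 pc po seg (I : Seg [::] o z)); rewrite /= sz; lia.
case oi0: (out o u i); last first.
  have fl : flip (out o u) i by split=> //; rewrite oi0.
  have [d [ds' [sz' seg']]] := up_chain fl ui.
  by left; apply: (Segs_Apex N0 pc po seg seg'); rewrite /= sz sz'; lia.
right; split=> //=.
by move: ui; rewrite dyn oi0 /maj; case: (z i); case: (out c u i).
Qed.

(** Followed backwards in time, the trace climbs until it turns down into another subtree, which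
    gives an apex inside [t], or it leaves [t] through the root. *)
Lemma trace N k t z T : 0 < N -> perf k t -> N + 5 <= T -> flips T t z ->
  HasApex N k t \/
  exists m i, [/\ i + m = T, down m i t z, 0 < i, ~~ z i.-1 & z i.+1].
Proof.
move=> N0; elim: t k z => [b|b l IHl r IHr] k z pk le.
  case=> // -[u0 u2]; right; exists 0, T; split => //; try lia.
  - by split=> //; exists [::].
  - case: T le u0 {u2} => [|T] le u0; first lia. by move: u0; rewrite outS_Lf.
  - by move: u2; rewrite outS_Lf.
case: k pk => // k [pl pr]; set t := Nd b l r; set u := out t z.
have dyn n : u n.+1 = maj (z n) (out l u n) (out r u n) by rewrite /u /t outS_Nd.
have dyn2 n : u n.+1 = maj (z n) (out r u n) (out l u n).
  by rewrite dyn /maj; case: (z n); case: (out l u n); case: (out r u n).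
have main d c o : c = child d t -> o = child (~~ d) t -> perf k c -> perf k o ->
    (forall n, u n.+1 = maj (z n) (out c u n) (out o u n)) ->
    (exists m i, [/\ i + m = T, down m i c u, 0 < i, ~~ u i.-1 & u i.+1]) ->
    Apex N k c o \/
    exists m i, [/\ i + m = T, down m i t z, 0 < i, ~~ z i.-1 & z i.+1].
  move=> Ec Eo pc po dy [m [i [im dn i0 ui ui2]]].
  have [||[i1 oi zi zi2]] := trace_step N0 pc po _ dy dn i0 ui ui2; first lia.
    by left.
  right; exists m.+1, i.-1; split; rewrite ?prednK //; try lia.
  split; first by split => //; rewrite prednK.
  case: dn => _ [ds [sz seg hd]]; exists ((d, i.-1) :: ds); split.
  - by rewrite /= sz.
  - rewrite -[Seg _ _ _]/[/\ _, _, _, _ & Seg ds _ _]; split => //.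
    + by rewrite -Eo prednK.
    + by case: ds {sz seg} hd => // -[_ i'] _ ->; left; rewrite prednK.
    + by rewrite -Ec.
  - by [].
case=> [[uT uT2]|[fl|fl]].
- case: T le uT uT2 {IHl IHr main} => [|T] le uT uT2; first lia.
  move: (uT) (uT2); rewrite -/t -/u !dyn => m1 m2.
  have [fz|fl|fr] := maj_flip m1 m2.
  + right; exists 0, T.+1; split => //; try lia; try by case: fz.
    by split => //; exists [::].
  + by left; constructor 1; apply: (child_flip_Apex (i := T) N0 pl pr fl uT); lia.
  + left; constructor 1; apply: Apex_sym.
    by apply: (child_flip_Apex (i := T) N0 pr pl fr uT); lia.
- have [|H] := IHl k u pl le fl; first by left; constructor 2.
  have [|] := main false l r erefl erefl pl pr dyn H; last by right.
  by left; constructor 1.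
- have [|H] := IHr k u pr le fl; first by left; constructor 3.
  have [|] := main true r l erefl erefl pr pl dyn2 H; last by right.
  by left; constructor 1; apply: Apex_sym.
Qed.

Lemma trace_root N k t1 t2 t3 (u : nat -> bool) T :
  0 < N -> perf k t1 -> perf k t2 -> perf k t3 -> N + 5 <= T ->
  (forall n, u n.+1 = maj (out t1 u n) (out t2 u n) (out t3 u n)) ->
  [\/ flip u T, flips T t1 u, flips T t2 u | flips T t3 u] ->
  [\/ HasApex N k t1, HasApex N k t2 | HasApex N k t3] \/
  [\/ Apex N k t1 t2, Apex N k t1 t3 | Apex N k t2 t3].
Proof.
move=> N0 p1 p2 p3 le dyn.
have main c o o' : perf k c -> perf k o -> perf k o' ->
    (forall n, u n.+1 = maj (out o' u n) (out c u n) (out o u n)) ->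
    flips T c u -> [\/ HasApex N k c, Apex N k c o | Apex N k c o'].
  move=> pc po po' dy fl.
  have [|[m [i [im dn i0 ui ui2]]]] := trace N0 pc le fl; first by constructor 1.
  have [||[i1 oi zi zi2]] := trace_step N0 pc po _ dy dn i0 ui ui2.
  - by lia.
  - by constructor 2.
  case: dn => _ [ds [sz seg hd]].
  have fl' : flip (out o' u) i.-2 by split => //; case: i i1 zi2 {im i0 ui ui2 oi zi hd} => [|[]].
  have [|d [ds' [sz' seg']]] := up_chain fl'; first by case: i i1 ui {im i0 ui2 oi zi zi2 hd fl'} => [|[]].
  constructor 3; apply: (Segs_Apex N0 pc po' seg seg'); rewrite /= sz sz'.
  by lia.
have P1 n : u n.+1 = maj (out t3 u n) (out t1 u n) (out t2 u n).
  by rewrite dyn; case: (out t1 u n) (out t2 u n) (out t3 u n) => [] [] [].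
have P2 n : u n.+1 = maj (out t3 u n) (out t2 u n) (out t1 u n).
  by rewrite dyn; case: (out t1 u n) (out t2 u n) (out t3 u n) => [] [] [].
have P3 n : u n.+1 = maj (out t2 u n) (out t3 u n) (out t1 u n).
  by rewrite dyn; case: (out t1 u n) (out t2 u n) (out t3 u n) => [] [] [].
case=> [[u0 u2]|f|f|f].
- case: T le u0 u2 {main} => [|T] le u0; first lia.
  rewrite dyn => m2; have u1 := u0.
  move: u0; rewrite dyn => m1; right.
  have [f|f|f] := maj_flip m1 m2.
  + by constructor 1; apply: (child_flip_Apex (i := T) N0 p1 p2 f u1); lia.
  + by constructor 3; apply: (child_flip_Apex (i := T) N0 p2 p3 f u1); lia.
  + by constructor 2; apply: Apex_sym; apply: (child_flip_Apex (i := T) N0 p3 p1 f u1); lia.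
- case: (main _ _ _ p1 p2 p3 P1 f) => H; first by left; constructor 1.
  + by right; constructor 1.
  + by right; constructor 2.
- case: (main _ _ _ p2 p1 p3 P2 f) => H; first by left; constructor 2.
  + by right; constructor 1; apply: Apex_sym.
  + by right; constructor 3.
- case: (main _ _ _ p3 p1 p2 P3 f) => H; first by left; constructor 3.
  + by right; constructor 2; apply: Apex_sym.
  + by right; constructor 3; apply: Apex_sym.
Qed.

(** * Uniform random trees *)

Section Prob.

Variable R : realFieldType.
Local Open Scope ring_scope.

Definition prob (T : finType) (E : T -> Prop) : R :=
  #|[set x | `[< E x >]]|%:R / #|T|%:R.

Lemma prob_ge0 (T : finType) (E : T -> Prop) : 0 <= prob E.
Proof. by rewrite divr_ge0. Qed.

Lemma prob_le (T : finType) (E F : T -> Prop) :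
  (forall x, E x -> F x) -> prob E <= prob F.
Proof.
move=> H; rewrite ler_wpM2r ?invr_ge0 ?ler0n // ler_nat subset_leq_card //.
by apply/subsetP => x; rewrite !inE => /asboolP/H/asboolP.
Qed.

Lemma prob_ext (T : finType) (E F : T -> Prop) :
  (forall x, E x <-> F x) -> prob E = prob F.
Proof.
by move=> H; apply/le_anti; rewrite !prob_le // => x /H.
Qed.

Lemma probU (T : finType) (E F : T -> Prop) :
  prob (fun x => E x \/ F x) <= prob E + prob F.
Proof.
rewrite -mulrDl ler_wpM2r ?invr_ge0 ?ler0n // -natrD ler_nat.
rewrite -cardsUI; apply: leq_trans (leq_addr _ _).
apply: subset_leq_card; apply/subsetP => x; rewrite !inE => /asboolP[] H.
  by apply/orP; left; apply/asboolP.
by apply/orP; right; apply/asboolP.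
Qed.

Lemma probU_disj (T : finType) (E F : T -> Prop) :
  (forall x, E x -> F x -> False) ->
  prob (fun x => E x \/ F x) = prob E + prob F.
Proof.
move=> H; rewrite -mulrDl -natrD -cardsUI.
have -> : [set x | `[< E x >]] :&: [set x | `[< F x >]] = set0.
  apply/setP => x; rewrite !inE; apply/negbTE/negP => /andP[/asboolP e /asboolP f].
  exact: (H x).
rewrite cards0 addn0; congr (_%:R / _); apply: eq_card => x.
by rewrite !inE -asbool_or.
Qed.

Lemma probM (T1 T2 : finType) (E : T1 -> Prop) (F : T2 -> Prop) :
  prob (fun x : T1 * T2 => E x.1 /\ F x.2) = prob E * prob F.
Proof.
rewrite /prob mulrACA -natrM -invfM -natrM -card_prod; congr (_%:R / _).
rewrite -cardsX; apply: eq_card => x.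
by rewrite !inE -asbool_and.
Qed.

Lemma probT (T : finType) : (0 < #|T|)%N -> prob (fun _ : T => True) = 1.
Proof.
move=> T0; rewrite /prob (_ : [set x | _] = setT) ?cardsT ?divff //.
  by rewrite pnatr_eq0 -lt0n.
by apply/setP => x; rewrite !inE; apply/asboolP.
Qed.

Lemma prob_fst (T1 T2 : finType) (E : T1 -> Prop) : (0 < #|T2|)%N ->
  prob (fun x : T1 * T2 => E x.1) = prob E.
Proof.
move=> T0; rewrite -[RHS]mulr1 -(probT T0) -probM; apply: prob_ext => x.
by split => [|[]].
Qed.

Lemma prob_snd (T1 T2 : finType) (E : T2 -> Prop) : (0 < #|T1|)%N ->
  prob (fun x : T1 * T2 => E x.2) = prob E.
Proof.
move=> T0; rewrite -[RHS]mul1r -(probT T0) -probM; apply: prob_ext => x.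
by split => [|[]].
Qed.

Lemma probC (T : finType) (E : T -> Prop) : (0 < #|T|)%N ->
  prob (fun x => ~ E x) = 1 - prob E.
Proof.
move=> T0; apply/eqP; rewrite eq_sym subr_eq eq_sym addrC.
rewrite -probU_disj; last by [].
by rewrite -(probT T0); apply/eqP/prob_ext => x; split => // _; exact: EM.
Qed.

Lemma prob_le1 (T : finType) (E : T -> Prop) : (0 < #|T|)%N -> prob E <= 1.
Proof. by move=> T0; rewrite -(probT T0) prob_le. Qed.

Lemma prob_bij (T1 T2 : finType) (f : T1 -> T2) (E : T2 -> Prop) :
  bijective f -> prob (fun x => E (f x)) = prob E.
Proof.
move=> bf; have inj := bij_inj bf; rewrite /prob (bij_eq_card bf); congr (_%:R / _).
rewrite -(card_imset _ inj); apply: eq_card => y; rewrite !inE.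
apply/imsetP/asboolP => [[x]|Ey]; first by rewrite inE => /asboolP e ->.
by case: bf => g fK gK; exists (g y); rewrite ?inE gK //; apply/asboolP.
Qed.

Lemma prob_bool (b : bool) : prob (fun x : bool => x = b) = 1 / 2.
Proof.
rewrite /prob card_bool (_ : [set x | _] = [set b]) ?cards1 //.
by apply/setP => x; rewrite !inE; apply/asboolP/eqP.
Qed.

Fixpoint PT (k : nat) : finType :=
  if k is j.+1 then ((bool * (PT j * PT j))%type : finType) else (bool : finType).

Fixpoint emb (k : nat) : PT k -> tr :=
  match k with
  | 0 => fun b => Lf b
  | j.+1 => fun x => Nd x.1 (emb x.2.1) (emb x.2.2)
  end.

Lemma emb_perf k (x : PT k) : perf k (emb x).
Proof. by elim: k x => //= k IH x. Qed.

Lemma card_PT_gt0 k : (0 < #|PT k|)%N.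
Proof. by elim: k => /= [|k IH]; rewrite ?card_bool // !card_prod card_bool !muln_gt0 IH. Qed.

Definition Pr (k : nat) (E : tr -> Prop) : R := prob (fun x : PT k => E (emb x)).

Lemma Pr_ge0 k E : 0 <= Pr k E. Proof. exact: prob_ge0. Qed.

Lemma Pr_le1 k E : Pr k E <= 1. Proof. by rewrite prob_le1 ?card_PT_gt0. Qed.

Lemma Pr_le k (E F : tr -> Prop) :
  (forall t, perf k t -> E t -> F t) -> Pr k E <= Pr k F.
Proof. by move=> H; apply: prob_le => x; apply: H; exact: emb_perf. Qed.

Lemma Pr_ext k (E F : tr -> Prop) :
  (forall t, perf k t -> (E t <-> F t)) -> Pr k E = Pr k F.
Proof. by move=> H; apply: prob_ext => x; apply: H; exact: emb_perf. Qed.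

Lemma PrU k (E F : tr -> Prop) : Pr k (fun t => E t \/ F t) <= Pr k E + Pr k F.
Proof. exact: probU. Qed.

Lemma PrU_disj k (E F : tr -> Prop) :
  (forall t, perf k t -> E t -> F t -> False) ->
  Pr k (fun t => E t \/ F t) = Pr k E + Pr k F.
Proof. by move=> H; apply: probU_disj => x; apply: H; exact: emb_perf. Qed.

Lemma PrC k E : Pr k (fun t => ~ E t) = 1 - Pr k E.
Proof. by rewrite /Pr probC ?card_PT_gt0. Qed.

Lemma PrT k (E : tr -> Prop) : (forall t, perf k t -> E t) -> Pr k E = 1.
Proof.
move=> H; rewrite -(probT (card_PT_gt0 k)); apply: prob_ext => x.
by split=> // _; apply: H; exact: emb_perf.
Qed.

Lemma PrF k (E : tr -> Prop) : (forall t, perf k t -> ~ E t) -> Pr k E = 0.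
Proof.
move=> H; have : Pr k (fun t => ~ E t) = 1 by exact: PrT.
by rewrite PrC; lra.
Qed.

Definition node (B : bool -> Prop) (E F : tr -> Prop) (t : tr) : Prop :=
  if t is Nd b l r then [/\ B b, E l & F r] else False.

Lemma Pr_node k B E F : Pr k.+1 (node B E F) = prob B * (Pr k E * Pr k F).
Proof.
rewrite -!probM; apply: prob_ext => -[b [l r]] /=.
by split => [[]|[? []]].
Qed.

Lemma Pr_nodeb k b E F : Pr k.+1 (node (eq^~ b) E F) = 1 / 2 * (Pr k E * Pr k F).
Proof. by rewrite Pr_node prob_bool. Qed.

Lemma Pr_nodeT k E F : Pr k.+1 (node (fun=> True) E F) = Pr k E * Pr k F.
Proof. by rewrite Pr_node probT ?card_bool // mul1r. Qed.

Lemma Pr_root k b : Pr k (fun t => root t = b) = 1 / 2.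
Proof.
case: k => [|k]; first exact: prob_bool.
transitivity (Pr k.+1 (node (eq^~ b) (fun=> True) (fun=> True))).
  by apply: Pr_ext => -[] //= ? ? ? _; split => [|[]].
by rewrite Pr_nodeb !(@PrT k (fun=> True)) // !mulr1.
Qed.

Fixpoint ngPT (k : nat) : PT k -> PT k :=
  match k with
  | 0 => fun b => ~~ b
  | j.+1 => fun x => (~~ x.1, (ngPT x.2.1, ngPT x.2.2))
  end.

Lemma ngPTK k : cancel (@ngPT k) (@ngPT k).
Proof. by elim: k => [|k IH] /= x; rewrite ?negbK ?IH //; case: x => ? []. Qed.

Lemma emb_ngPT k x : emb (@ngPT k x) = neg (emb x).
Proof. by elim: k x => //= k IH x; rewrite !IH. Qed.

Lemma Pr_neg k (E : tr -> Prop) : Pr k (fun t => E (neg t)) = Pr k E.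
Proof.
rewrite /Pr -(prob_bij (fun x => E (emb x)) (Bijective (@ngPTK k) (@ngPTK k))).
by apply: prob_ext => x; rewrite emb_ngPT.
Qed.

End Prob.

(** * Upper bounds for the sites of a causal path *)

(** Under a parent in - the first return to + needs both children in + at once. The vertex has been
    - since [n0], so the children have seen only - since then. *)
Lemma first_plus b l r z n0 n (w := out (Nd b l r) z) :
  n0 < n -> ~~ odd (n0 + n) -> ~~ w n0 -> w n ->
  (forall s, n0 < s -> s < n -> odd (s + n) -> ~~ z s) ->
  exists m, [/\ n0 < m, m < n, odd (m + n), out l w m /\ out r w m &
    forall s, n0 <= s -> s <= m -> odd (s + m) -> ~~ w s].
Proof.
move: {2}(n - n0)%N (leqnn (n - n0)) => d.
elim: d n0 => [|d IH] n0 le lt od w0 wn zH; first by plia.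
have z1 : ~~ z n0.+1 by apply: zH; plia.
case w2: (w n0.+2).
  exists n0.+1; split; try plia.
    move: w2; rewrite /w outS_Nd -/w (negbTE z1) /maj /=.
    by case: (out l w _); case: (out r w _).
  by move=> s s0 s1 os; have -> : s = n0 by plia.
have lt2 : n0.+2 < n.
  have : n0.+2 != n by apply: contraTneq wn => <-; rewrite w2.
  by plia.
have zH2 s : n0.+2 < s -> s < n -> odd (s + n) -> ~~ z s.
  by move=> ? ? ?; apply: zH => //; plia.
have le2 : n - n0.+2 <= d by plia.
have od2 : ~~ odd (n0.+2 + n) by plia.
have [m [m0 mn mo cc wm]] := IH n0.+2 le2 lt2 od2 (negbT w2) wn zH2.
exists m; split=> //; first by plia.
move=> s s0 sm os; case: (leqP n0.+2 s) => s2; first exact: wm.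
by have -> : s = n0 by plia.
Qed.

Lemma out_below t w m :
  (forall s, s <= m -> odd (s + m) -> ~~ w s) ->
  out t w m = out t (fun=> false) m.
Proof. by move=> H; apply: out_eq => s sm os; apply/negbTE/H => //; plia. Qed.

(** Separated from [QEv false] because it is much rarer (about 0.04 against 0.32) and the late cases
    of [QB_children] and [QA_plus_children] pass through it. *)
Definition QmEv (t : tr) : Prop := root t = false /\ QEv false t.

Lemma Qm_children b l r : QmEv (Nd b l r) -> QEv true l /\ QEv true r.
Proof.
move=> [/= b0 [n [n0 on wn]]].
have [||||s|m [m0 mn mo [cl cr] wm]] := @first_plus b l r (fun=> false) 0 n => //.
- by rewrite add0n on.
- by rewrite /out /= b0.
have below s : s <= m -> odd (s + m) -> ~~ out (Nd b l r) (fun=> false) s.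
  exact: wm.
by split; exists m; rewrite -(out_below _ below); split => //; plia.
Qed.

Lemma QB_children b l r : QEv true (Nd b l r) ->
  [\/ root l = true /\ root r = true, QmEv l /\ QEv false r | QEv false l /\ QmEv r].
Proof.
move=> [n [n0 on wn]]; set w := out (Nd b l r) (fun=> false) in wn.
have w1 : w 1 = root l && root r by rewrite /w outS_Nd /maj /= /out /=; case: (root l); case: (root r).
case E: (w 1); first by rewrite w1 in E; constructor 1; case/andP: E.
have n1 : 1 < n by have : n != 1 by [apply: contraTneq wn => ->; rewrite E]; plia.
have [||||s|m [m0 mn mo [cl cr] wm]] := @first_plus b l r (fun=> false) 1 n => //.
- by plia.
- by rewrite -/w E.
have below : forall s, s <= m -> odd (s + m) -> ~~ w s by move=> s sm os; apply: wm => //; plia.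
have ql : QEv false l by exists m; split; [plia..|rewrite -(out_below _ below)].
have qr : QEv false r by exists m; split; [plia..|rewrite -(out_below _ below)].
move: E; rewrite w1; case El: (root l) => /= Er; first by constructor 3.
by constructor 2.
Qed.

Definition both (E : tr -> Prop) (t : tr) : Prop := node (fun=> True) E E t.

(** The root is + at time 2 only if both children are + at time 1. A child that is - at time 1,
    although its parent starts in +, has two children starting in -, and both of these must reach +
    under it later. *)
Lemma QA_plus_children l r : QEv false (Nd true l r) ->
  [\/ out l (fun=> true) 1 /\ out r (fun=> true) 1, both QmEv l | both QmEv r].
Proof.
move=> [n [n0 on wn]]; set w := out (Nd true l r) (fun=> false) in wn.
have c1 c : out c w 1 = out c (fun=> true) 1 by apply: out_eq => -[].
have w2 : w 2 = out l w 1 && out r w 1.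
  by rewrite /w outS_Nd -/w /maj /=; case: (out l w 1); case: (out r w 1).
case E: (w 2); first by rewrite w2 in E; constructor 1; rewrite -!c1; case/andP: E.
have n2 : 2 < n by have : n != 2 by [apply: contraTneq wn => ->; rewrite E]; plia.
have [||||s|m [m0 mn mo [cl cr] wm]] := @first_plus true l r (fun=> false) 2 n => //.
- by plia.
- by rewrite -/w E.
have main c : out c w m -> ~~ out c w 1 -> both QmEv c.
  case: c => [b'|b' ll lr] cm ncm; first by move: ncm; rewrite outS_Lf.
  have [||||s s1 sm os|m' [m1 m1n m1o [cll clr] cw]] := @first_plus b' ll lr w 1 m => //.
  - by plia.
  - by plia.
  - by apply: wm => //; plia.
  have below : forall s, s <= m' -> odd (s + m') -> ~~ out (Nd b' ll lr) w s.
    by move=> s sm os; apply: cw => //; plia.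
  have [rl rr] : root ll = false /\ root lr = false.
    move: ncm; rewrite outS_Nd /maj /out /= -/w.
    by case: (root ll); case: (root lr).
  split=> //; split => //; exists m'; split; try plia.
    by rewrite -(out_below _ below).
  by rewrite -(out_below _ below).
move: E; rewrite w2; case El: (out l w 1) => /= Er.
  by constructor 3; apply: main => //; rewrite Er.
by constructor 2; apply: main => //; rewrite El.
Qed.

(** A vertex that has been - throughout needs two children reaching + under a constant -. Otherwise
    let [t] be its last + before [n]: some child is - at [t + 1] in spite of this +, so both
    children of that child are - at [t], and they turn + later while their parent is -. Two bad
    grandchildren make the recursion quadratic. *)
Lemma Bad_children p b l r : BadEv p (Nd b l r) ->
  [\/ [/\ QEv (~~ p) l, QEv (~~ p) r &
          if p then root l = false \/ root r = false else b = false],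
      both (BadEv p) l | both (BadEv p) r].
Proof.
move=> [z [n [on wn wn2 zn]]]; set w := out (Nd b l r) z in wn wn2.
have [cl cr] : out l w n.+1 /\ out r w n.+1.
  move: wn2; rewrite /w outS_Nd -/w (negbTE zn) /maj /=.
  by case: (out l w _); case: (out r w _).
case: (pselect (clean w n)) => [clw|].
  have below : forall s, s <= n.+1 -> odd (s + n.+1) -> ~~ w s.
    by move=> s sn os; apply: clw; plia.
  constructor 1; split.
  - by exists n.+1; rewrite -(out_below _ below) /= on.
  - by exists n.+1; rewrite -(out_below _ below) /= on.
  case: p on => on.
    have : ~~ w 1 by apply: clw; plia.
    rewrite /w outS_Nd /out /= /maj.
    by case: (root l); case: (root r); [rewrite orbT andbT; case: (z 0)|right|left|left].
  by apply/negbTE/(clw 0) => //; rewrite add0n on.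
move=> /not_clean [t0 [le0 od0 wt0]].
have [t [_ le od wt wf]] := last_plus le0 od0 wt0 wn.
have main c : out c w n.+1 -> ~~ out c w t.+1 -> both (BadEv p) c.
  case: c => [b'|b' ll lr] cn ct; first by move: ct; rewrite outS_Lf wt.
  set v := out (Nd b' ll lr) w in cn ct.
  have [||||s s1 sm os|m [m1 m1n m1o [cll clr] cw]] :=
    @first_plus b' ll lr w t.+1 n.+1 => //; try plia.
    by apply: wf; plia.
  have [rl rr] : ~~ out ll v t /\ ~~ out lr v t.
    move: ct; rewrite /v outS_Nd -/v wt /maj.
    by case: (out ll v t); case: (out lr v t).
  have bd d : ~~ out d v t -> out d v m -> BadEv p d.
    case: m m1 m1n m1o cw {cll clr} => // m m1 m1n m1o cw dt dm.
    have [|||||s [os o1 o2 u1]] := @late_change_bad v (out d v) m t => //; [plia|plia| |].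
      by move=> s ts sm os; apply: cw; plia.
    by exists v, s; split => //; plia.
  by split=> //; exact: bd.
have : ~~ w t.+2 by apply: wf; plia.
rewrite /w outS_Nd -/w /maj.
case El: (out l w t.+1); last by move=> _; constructor 2; apply: main; rewrite ?El.
case Er: (out r w t.+1); last by move=> _; constructor 3; apply: main; rewrite ?Er.
by rewrite orbT andbT; case: (z _).
Qed.

Definition EverEv (p : bool) (t : tr) : Prop :=
  exists z n, odd n = p /\ out t z n.

Lemma Can_children p b l r : CanEv p (Nd b l r) -> EverEv (~~ p) l /\ EverEv (~~ p) r.
Proof.
move=> [z [n [on zn]]]; rewrite outS_Nd (negbTE zn) /maj /=; set w := out _ z.
move=> H; have {H} [cl cr] : out l w n /\ out r w n.
  by case: (out l w n) H; case: (out r w n).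
by split; exists w, n; split => //; rewrite -on /= negbK.
Qed.

Lemma first_ever p t : EverEv p t -> exists z n, [/\ odd n = p, out t z n &
  forall s, s < n -> ~~ odd (s + n) -> ~~ out t z s].
Proof.
move=> [z [n0 [on0 tn0]]].
have ex : exists n, (odd n == p) && out t z n by exists n0; rewrite on0 eqxx.
case: (ex_minnP ex) => n /andP[/eqP on tn] H; exists z, n; split => // s sn os.
by apply/negP => ts; have := H s; rewrite ts andbT => /(_ _)/wrap[]; [apply/eqP; plia | plia].
Qed.

Lemma Ever_false b l r : EverEv false (Nd b l r) ->
  [\/ b = true, QEv true l | QEv true r].
Proof.
move=> /first_ever [z [n [on tn H]]].
case: n on tn H => [|n] on tn H; first by constructor 1; exact: tn.
set w := out _ z in tn H.
have below : forall s, s <= n -> odd (s + n) -> ~~ w s by move=> s sn os; apply: H; plia.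
move: tn; rewrite /w outS_Nd -/w /maj.
case El: (out l w n); first by move=> _; constructor 2; exists n; rewrite -(out_below _ below); split => //; plia.
case Er: (out r w n); first by move=> _; constructor 3; exists n; rewrite -(out_below _ below); split => //; plia.
by rewrite /= andbF.
Qed.

Lemma Ever_true b l r : EverEv true (Nd b l r) ->
  [\/ root l = true \/ root r = true, QmEv l /\ root r = false |
      root l = false /\ QmEv r].
Proof.
move=> /first_ever [z [n [on tn H]]].
case rl: (root l); first by constructor 1; left.
case rr: (root r); first by constructor 1; right.
set w := out _ z in tn H.
case: n on tn H => // n on tn H.
have n0 : 0 < n.
  case: n on tn H => // _; rewrite /w outS_Nd /out /= rl rr /maj /=; by case: (z 0).
have below : forall s, s <= n -> odd (s + n) -> ~~ w s by move=> s sn os; apply: H; plia.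
move: tn; rewrite /w outS_Nd -/w /maj.
case El: (out l w n).
  by move=> _; constructor 2; split => //; split => //; exists n; rewrite -(out_below _ below); split => //; plia.
case Er: (out r w n).
  by move=> _; constructor 3; split => //; split => //; exists n; rewrite -(out_below _ below); split => //; plia.
by rewrite /= andbF.
Qed.

Lemma out1_true b l r : out (Nd b l r) (fun=> true) 1 -> root l = true \/ root r = true.
Proof. by rewrite outS_Nd /maj /out /=; case: (root l); case: (root r) => //=; [left|left|right]. Qed.

Lemma Q_Lf b p : ~ QEv p (Lf b).
Proof. by move=> [[|n] [//= _ _]]; rewrite outS_Lf. Qed.

Lemma Bad_Lf b p : ~ BadEv p (Lf b).
Proof. by move=> [z [n [_ _]]]; rewrite outS_Lf => ->. Qed.

(** * Recursive probability bounds for the site events *)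

Section UpperProb.

Variable R : realFieldType.
Local Open Scope ring_scope.
Local Notation Pr := (@Pr R).

Lemma Pr_leU k (E F G : tr -> Prop) (a b : R) :
  (forall t, perf k t -> E t -> F t \/ G t) -> Pr k F <= a -> Pr k G <= b ->
  Pr k E <= a + b.
Proof.
move=> H Fa Gb; apply: le_trans (Pr_le R H) _.
by apply: le_trans (PrU R k F G) (lerD Fa Gb).
Qed.

Lemma Pr_nodeT_le k (E F : tr -> Prop) (a b : R) :
  Pr k E <= a -> Pr k F <= b -> Pr k.+1 (node (fun=> True) E F) <= a * b.
Proof. by move=> Ea Fb; rewrite Pr_nodeT ler_pM ?Pr_ge0. Qed.

Lemma Pr_nodeb_le k c (E F : tr -> Prop) (a b : R) :
  Pr k E <= a -> Pr k F <= b -> Pr k.+1 (node (eq^~ c) E F) <= 1 / 2 * (a * b).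
Proof. by move=> Ea Fb; rewrite Pr_nodeb ler_wpM2l ?ler_pM ?Pr_ge0 //; lra. Qed.

Lemma Pr_both_le k E (a : R) : 0 <= a ->
  (forall j, (j < k)%N -> Pr j E <= a) -> Pr k (both E) <= a ^+ 2.
Proof.
move=> a0 H; case: k H => [|k] H; last by rewrite expr2; apply: Pr_nodeT_le; exact: H.
have -> : Pr 0 (both E) = 0 by apply: PrF => -[b _ []|b l r []].
by rewrite exprn_ge0.
Qed.

Lemma Pr_out1 k : (0 < k)%N -> Pr k (fun t => out t (fun=> true) 1) <= 3 / 4.
Proof.
case: k => // k _.
have -> : 3 / 4 = 1 / 2 * 1 + 1 / 2 * (1 / 2) :> R by lra.
apply: (@Pr_leU _ _ (node (fun=> True) (fun t => root t = true) (fun=> True))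
  (node (fun=> True) (fun t => root t = false) (fun t => root t = true))).
- case=> [//|b l r] _ /out1_true /=; case: (root l) => [|[]//]; first by left.
  by right.
- by apply: Pr_nodeT_le; rewrite ?Pr_root ?Pr_le1.
- by apply: Pr_nodeT_le; rewrite Pr_root.
Qed.

(* pB, la and pA bound P(QEv true), P(QmEv) and P(QEv false); the hypotheses say
   that these bounds pass from the children to the parent. *)
Section Constants.

Variables pB la pA : R.
Hypotheses (pB0 : 0 <= pB) (la0 : 0 <= la) (pA0 : 0 <= pA).
Hypothesis HpB : 1 / 4 + 2 * (la * pA) <= pB.
Hypothesis Hla : 1 / 2 * (pB * pB) <= la.
Hypothesis HpA : la + (9 / 32 + la ^+ 2) <= pA.

(** The product is carried separately because of small heights: at height 1 the event [QEv false]
    has probability 1/2, which may exceed [pA], but there [QmEv] is impossible. *)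
Lemma upper_Q k :
  [/\ Pr k (QEv true) <= pB, Pr k QmEv <= la,
      Pr k QmEv * Pr k (QEv false) <= la * pA &
      (2 <= k)%N -> Pr k (QEv false) <= pA].
Proof.
elim/ltn_ind: k => -[|k] IH.
  have F0 p : Pr 0 (QEv p) = 0 by apply: PrF => -[b|//] _; exact: Q_Lf.
  have G0 : Pr 0 QmEv = 0 by apply: PrF => -[b|//] _ [_ /Q_Lf].
  by rewrite !F0 G0 mul0r mulr_ge0.
have [hB hm hmA hA] := IH k (ltnSn k).
have B1 : Pr k.+1 (QEv true) <= pB.
  apply: le_trans HpB; have -> : 1 / 4 = 1 / 2 * (1 / 2) :> R by lra.
  apply: (@Pr_leU _ _ (node (fun=> True) (fun t => root t = true) (fun t => root t = true))
    (fun t => node (fun=> True) QmEv (QEv false) t \/ node (fun=> True) (QEv false) QmEv t)).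
  - by case=> [//|b l r] _ /QB_children /= [[]|[]|[]]; [left|right; left|right; right].
  - by apply: Pr_nodeT_le; rewrite Pr_root.
  - apply: le_trans (PrU _ _ _ _) _; rewrite !Pr_nodeT [X in _ + X]mulrC.
    by rewrite mulr_natl mulr2n lerD.
have m1' : Pr k.+1 QmEv <= 1 / 2 * (Pr k (QEv true) * Pr k (QEv true)).
  rewrite -(Pr_nodeb R k false); apply: Pr_le => -[b _ [_ /Q_Lf //]|b l r _ Hq].
  by have [? ?] := Qm_children Hq; case: Hq.
have m1 : Pr k.+1 QmEv <= la.
  apply: le_trans m1' (le_trans _ Hla).
  by rewrite ler_wpM2l ?ler_pM ?Pr_ge0 //; lra.
have A1 : (0 < k)%N -> Pr k.+1 (QEv false) <= pA.
  move=> k0.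
  have le2 : Pr k (both QmEv) <= la ^+ 2.
    apply: Pr_both_le => // j jk.
    by have [] := IH j (ltnW jk : (j < k.+1)%N).
  have T1 : Pr k (fun=> True) <= 1 by exact: Pr_le1.
  have O1 := Pr_out1 k0.
  apply: le_trans HpA.
  have -> : 9 / 32 + la ^+ 2 = 1 / 2 * (3 / 4 * (3 / 4)) +
      (1 / 2 * (la ^+ 2 * 1) + 1 / 2 * (1 * la ^+ 2)) by field.
  apply: (@Pr_leU _ _ QmEv (fun t => node (eq^~ true) (fun t => out t (fun=> true) 1)
        (fun t => out t (fun=> true) 1) t \/
      (node (eq^~ true) (both QmEv) (fun=> True) t \/
       node (eq^~ true) (fun=> True) (both QmEv) t))) => //.
    case=> [b _ /Q_Lf //|[] l r _ Hq]; last by left.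
    by right; have [[]|?|?] := QA_plus_children Hq; [left|right; left|right; right].
  apply: le_trans (PrU _ _ _ _) (lerD _ _); first exact: Pr_nodeb_le.
  by apply: le_trans (PrU _ _ _ _) (lerD _ _); exact: Pr_nodeb_le.
split=> //; case: k {IH hm hmA hA B1} hB m1' m1 A1 => [|k] hB m1' m1 A1.
  have E0 : Pr 0 (QEv true) = 0 by apply: PrF => -[b|//] _; exact: Q_Lf.
  rewrite E0 !mul0r mulr0 in m1'.
  have -> : Pr 1 QmEv = 0 by apply/le_anti; rewrite m1' Pr_ge0.
  by rewrite mul0r mulr_ge0.
by apply: ler_pM; rewrite ?Pr_ge0 ?A1.
Qed.

(** In the last hypothesis [b] stands for the clean case of [Bad_children], and each of its two
    pairs of bad grandchildren contributes a^2. *)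
Lemma Bad_le (p : bool) (a b : R) k : 0 <= a ->
  (forall j, Pr j.+1 (fun t => if t is Nd b l r then
      [/\ QEv (~~ p) l, QEv (~~ p) r &
          if p then root l = false \/ root r = false else b = false]
     else False) <= b) -> b + 2 * a ^+ 2 <= a ->
  Pr k (BadEv p) <= a.
Proof.
move=> a0 Hb ab; elim/ltn_ind: k => -[|k] IH.
  have -> : Pr 0 (BadEv p) = 0 by apply: PrF => -[c _ /Bad_Lf|c l r []].
  by [].
have le2 : Pr k (both (BadEv p)) <= a ^+ 2.
  by apply: Pr_both_le => // j jk; apply: IH; lia.
have T1 : Pr k (fun=> True) <= 1 by exact: Pr_le1.
apply: (@le_trans _ _ (b + (a ^+ 2 * 1 + 1 * a ^+ 2))); last by lra.
apply: Pr_leU (Hb k) (_ : Pr k.+1 (fun t => node (fun=> True) (both (BadEv p)) (fun=> True) t \/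
  node (fun=> True) (fun=> True) (both (BadEv p)) t) <= _).
  case=> [//|c l r] _ /Bad_children [?|?|?]; first by left.
  - by right; left.
  - by right; right.
by apply: le_trans (PrU _ _ _ _) (lerD _ _); exact: Pr_nodeT_le.
Qed.

Lemma BadA_le k (a : R) : 0 <= a -> la + 2 * a ^+ 2 <= a -> Pr k (BadEv false) <= a.
Proof.
move=> a0 Ha; apply: (@Bad_le _ _ la) => // j; have [hB _ _ _] := upper_Q j.
apply: le_trans Hla; apply: le_trans (Pr_nodeb_le false hB hB).
by apply: Pr_le => -[//|b l r] _ [].
Qed.

Lemma BadB_le k (a : R) : 0 <= a -> 2 * (la * pA) + 2 * a ^+ 2 <= a ->
  Pr k (BadEv true) <= a.
Proof.
move=> a0 Ha; apply: (@Bad_le _ _ (2 * (la * pA))) => // j.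
have [_ _ hmA _] := upper_Q j.
apply: (@le_trans _ _ (Pr j.+1 (fun t => node (fun=> True) QmEv (QEv false) t \/
   node (fun=> True) (QEv false) QmEv t))).
  by apply: Pr_le => -[//|b l r] _ [/= ? ? [?|?]]; [left|right].
apply: le_trans (PrU _ _ _ _) _; rewrite !Pr_nodeT [X in _ + X]mulrC.
by rewrite mulr_natl mulr2n lerD.
Qed.

Lemma EverB_le k : (0 < k)%N -> Pr k (EverEv true) <= 3 / 4 + la.
Proof.
case: k => // k _; have [_ hm _ _] := upper_Q k.
have -> : 3 / 4 + la = (1 / 2 * 1 + 1 / 2 * (1 / 2)) + (la * (1 / 2) + 1 / 2 * la).
  by field.
have rt b : Pr k (fun t => root t = b) <= 1 / 2 by rewrite Pr_root.
have T1 : Pr k (fun=> True) <= 1 by exact: Pr_le1.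
apply: (@Pr_leU _ _ (fun t => node (fun=> True) (fun t => root t = true) (fun=> True) t \/
   node (fun=> True) (fun t => root t = false) (fun t => root t = true) t)
  (fun t => node (fun=> True) QmEv (fun t => root t = false) t \/
   node (fun=> True) (fun t => root t = false) QmEv t)).
- case=> [//|b l r] _.
  move=> /Ever_true /= [H|[? ?]|[? ?]]; [|by right; left|by right; right].
  by left; case: (root l) H => [|[]//]; [left|right].
- by apply: le_trans (PrU _ _ _ _) (lerD _ _); apply: Pr_nodeT_le.
- by apply: le_trans (PrU _ _ _ _) (lerD _ _); apply: Pr_nodeT_le.
Qed.

Lemma EverA_le k : (0 < k)%N -> Pr k (EverEv false) <= 1 / 2 + pB.
Proof.
case: k => // k _; have [hB _ _ _] := upper_Q k.
have T1 : Pr k (fun=> True) <= 1 by exact: Pr_le1.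
have -> : 1 / 2 + pB = 1 / 2 * (1 * 1) + (1 / 2 * (pB * 1) + 1 / 2 * (1 * pB)).
  by field.
apply: (@Pr_leU _ _ (node (eq^~ true) (fun=> True) (fun=> True))
  (fun t => node (eq^~ false) (QEv true) (fun=> True) t \/
   node (eq^~ false) (fun=> True) (QEv true) t)).
- case=> [//|b l r] _.
  move=> /Ever_false /=; case: b; first by left.
  by case=> // ?; right; [left|right].
- exact: Pr_nodeb_le.
- by apply: le_trans (PrU _ _ _ _) (lerD _ _); apply: Pr_nodeb_le.
Qed.

Lemma Can_le p k (a : R) : (2 <= k)%N ->
  (3 / 4 + la) ^+ 2 <= a -> (1 / 2 + pB) ^+ 2 <= a -> Pr k (CanEv p) <= a.
Proof.
case: k => // k k0 H1 H2; have k1 : (0 < k)%N by [].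
apply: (@le_trans _ _ (Pr k.+1 (node (fun=> True) (EverEv (~~ p)) (EverEv (~~ p))))).
  by apply: Pr_le => -[//|b l r] _ /Can_children [? ?].
rewrite Pr_nodeT; case: p => /=.
  by apply: le_trans H2; rewrite expr2; apply: ler_pM; rewrite ?Pr_ge0 ?EverA_le.
by apply: le_trans H1; rewrite expr2; apply: ler_pM; rewrite ?Pr_ge0 ?EverB_le.
Qed.

End Constants.

(* A strict supersolution for the transfer matrix of [know], with growth rate
   [chain_rate] < 1 / 2. *)
Definition chain_weight (s : know) (p : bool) : R :=
  match s, p with
  | KN, false => 19 / 5 | KE, false => 23 / 5 | KB, false => 8 | KP, false => 1
  | KN, true => 59 / 10 | KE, true => 4 | KB, true => 91 / 10 | KP, true => 7 / 5
  end.

Lemma site_bounds k : (2 <= k)%N ->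
  [/\ Pr k (QEv true) <= 11 / 40, Pr k (QEv false) <= 641 / 2000,
      Pr k (BadEv false) <= 1 / 24, Pr k (BadEv true) <= 1 / 38 &
      forall p, Pr k (CanEv p) <= 5 / 8].
Proof.
(* The value of [la] gives equality in [H2]; 11/40 and 641/2000 are round values that satisfy the
   other two recursions with little room. *)
move=> k2; pose la : R := (11 / 40) * (11 / 40) / 2.
have la0 : 0 <= la by rewrite /la; lra.
have pB0 : 0 <= 11 / 40 :> R by lra.
have pA0 : 0 <= 641 / 2000 :> R by lra.
have H1 : 1 / 4 + 2 * (la * (641 / 2000)) <= 11 / 40 by rewrite /la; lra.
have H2 : 1 / 2 * (11 / 40 * (11 / 40)) <= la by rewrite /la; lra.
have H3 : la + (9 / 32 + la ^+ 2) <= 641 / 2000 by rewrite /la; lra.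
have [hB _ _ hA] := upper_Q pB0 la0 pA0 H1 H2 H3 k.
split=> //; first exact: hA.
- by apply: (BadA_le pB0 la0 pA0 H1 H2 H3); rewrite /la; lra.
- by apply: (BadB_le pB0 la0 pA0 H1 H2 H3); rewrite /la; lra.
- by move=> p; apply: (Can_le pB0 la0 pA0 H1 H2 H3) => //; rewrite /la; lra.
Qed.

(** Both directions at a site are included; a single path has half this rate. *)
Definition chain_rate : R := 97 / 200.

Lemma Chain_step n s p k (C : R) :
  (2 <= k)%N -> 0 <= C -> (forall s, Pr k (Chain n s (~~ p)) <= chain_weight s (~~ p) * C) ->
  Pr k.+1 (Chain n.+1 s p) <= chain_weight s p * (chain_rate * C).
Proof.
move=> k2 C0 H.
have [hB hA bA bB cn] := site_bounds k2.
pose Bq (b : bool) : Prop := p \/ ~~ b.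
have PB : prob R Bq <= if p then 1 else 1 / 2.
  case: p @Bq {H} => Bq; first by rewrite prob_le1 ?card_bool.
  by rewrite -(prob_bool R false); apply: prob_le => b [//|/negbTE].
have LE : Pr k.+1 (Chain n.+1 s p) <=
   2 * ((if may_clean s then prob R Bq * (Pr k (QEv (~~ p)) * Pr k (Chain n KN (~~ p))) else 0) +
     Pr k (BadEv (~~ p)) * Pr k (Chain n (after_bad s) (~~ p)) +
     (if may_can s then Pr k (CanEv (~~ p)) * Pr k (Chain n KP (~~ p)) else 0)).
  pose D (d : bool) (t : tr) : Prop := match t with Lf _ => False | Nd b l r =>
        let c := if d then r else l in
        let off := if d then l else r in
        [\/ [/\ may_clean s, CleanEv p b off & Chain n KN (~~ p) c],
            BadEv (~~ p) off /\ Chain n (after_bad s) (~~ p) c |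
            [/\ may_can s, CanEv (~~ p) off & Chain n KP (~~ p) c]] end.
  rewrite mulr_natl mulr2n; apply: (@Pr_leU _ _ (D true) (D false)).
  - by case=> [//|b l r] _ [[] H']; [left|right].
  - apply: (@Pr_leU _ _ (fun t => (may_clean s /\ node Bq (QEv (~~ p)) (Chain n KN (~~ p)) t) \/
        node (fun=> True) (BadEv (~~ p)) (Chain n (after_bad s) (~~ p)) t)
       (fun t => may_can s /\ node (fun=> True) (CanEv (~~ p)) (Chain n KP (~~ p)) t)).
    + by case=> [//|b l r] _ /= [[? [? ?] ?]|[? ?]|[? ? ?]]; [left; left|left; right|right].
    + apply: le_trans (PrU _ _ _ _) (lerD _ _); last by rewrite Pr_nodeT.
      case: (may_clean s); first by rewrite -Pr_node; apply: Pr_le => t _ [].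
      by rewrite (@PrF R) // => t _ [].
    + case: (may_can s); first by rewrite -Pr_nodeT; apply: Pr_le => t _ [].
      by rewrite (@PrF R) // => t _ [].
  - apply: (@Pr_leU _ _ (fun t => (may_clean s /\ node Bq (Chain n KN (~~ p)) (QEv (~~ p)) t) \/
        node (fun=> True) (Chain n (after_bad s) (~~ p)) (BadEv (~~ p)) t)
       (fun t => may_can s /\ node (fun=> True) (Chain n KP (~~ p)) (CanEv (~~ p)) t)).
    + by case=> [//|b l r] _ /= [[? [? ?] ?]|[? ?]|[? ? ?]]; [left; left|left; right|right].
    + apply: le_trans (PrU _ _ _ _) (lerD _ _); last by rewrite Pr_nodeT mulrC.
      case: (may_clean s); first by rewrite [Pr _ _ * _]mulrC -Pr_node; apply: Pr_le => t _ [].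
      by rewrite (@PrF R) // => t _ [].
    + case: (may_can s); first by rewrite mulrC -Pr_nodeT; apply: Pr_le => t _ [].
      by rewrite (@PrF R) // => t _ [].
apply: le_trans LE _.
have B0 : 0 <= prob R Bq by exact: prob_ge0.
have tC : prob R Bq * (Pr k (QEv (~~ p)) * Pr k (Chain n KN (~~ p))) <=
    (if p then 641 / 2000 else 11 / 80) * (chain_weight KN (~~ p) * C).
  rewrite mulrA; apply: ler_pM => //; [by rewrite mulr_ge0 ?Pr_ge0|exact: Pr_ge0|].
  apply: (@le_trans _ _ ((if p then 1 else 1 / 2) * (if p then 641 / 2000 else 11 / 40))).
    by apply: ler_pM; rewrite ?Pr_ge0 //; case: (p).
  by case: (p); lra.
have tb q : Pr k (BadEv (~~ p)) * Pr k (Chain n q (~~ p)) <=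
    (if p then 1 / 24 else 1 / 38) * (chain_weight q (~~ p) * C).
  by apply: ler_pM; rewrite ?Pr_ge0 //; case: (p).
have tc : Pr k (CanEv (~~ p)) * Pr k (Chain n KP (~~ p)) <= 5 / 8 * (chain_weight KP (~~ p) * C).
  by apply: ler_pM; rewrite ?Pr_ge0.
have {}tb := tb (after_bad s).
move: tC tb tc; move: (prob R Bq * _) (Pr k (BadEv _) * _) (Pr k (CanEv _) * _).
move=> X1 X2 X3 tC tb tc; clear -C0 tC tb tc; rewrite /chain_rate.
(* One linear inequality for each of the eight pairs of state and parity: this is the supersolution
   property of [chain_weight]. *)
move: tC tb tc; case: s; case: p => /= tC tb tc; lra.
Qed.

Lemma Chain_le n s p k : (n.+2 <= k)%N -> Pr k (Chain n s p) <= chain_weight s p * chain_rate ^+ n.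
Proof.
elim: n s p k => [|n IH] s p k le.
  by rewrite expr0 mulr1; apply: le_trans (Pr_le1 _ _ _) _; case: s; case: p => /=; lra.
case: k le => // k le; rewrite exprS; apply: Chain_step; first by lia.
  by rewrite exprn_ge0 // /chain_rate; lra.
by move=> q; apply: IH.
Qed.

Lemma Apex_chains_le na nc pa pc k : (na.+2 <= k)%N -> (nc.+2 <= k)%N ->
  Pr k (Chain na KB pa) * Pr k (Chain nc KB pc) <= 100 * chain_rate ^+ (na + nc).
Proof.
move=> la1 la2; have x0 : 0 <= chain_rate by rewrite /chain_rate; lra.
have w10 p : chain_weight KB p <= 10 by case: p => /=; lra.
apply: (@le_trans _ _ ((10 * chain_rate ^+ na) * (10 * chain_rate ^+ nc))).
  by apply: ler_pM; rewrite ?Pr_ge0 //;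
     apply: le_trans (Chain_le _ _ _) _ => //; rewrite ler_wpM2r ?exprn_ge0.
by rewrite mulrACA -exprD; lra.
Qed.

End UpperProb.

(** * Instability of the whole tree is unlikely *)

Record wtree := WT { wb : bool; w1 : tr; w2 : tr; w3 : tr }.

Definition wstep (w : wtree) : wtree :=
  WT (maj (root (w1 w)) (root (w2 w)) (root (w3 w)))
     (step (w1 w) (wb w)) (step (w2 w) (wb w)) (step (w3 w) (wb w)).

Definition wout (w : wtree) (n : nat) : bool := wb (iter n wstep w).

Lemma iter_wstep w n : iter n wstep w =
  WT (wout w n) (state (w1 w) (wout w) n) (state (w2 w) (wout w) n)
     (state (w3 w) (wout w) n).
Proof. by elim: n => [|n IH] /=; [case: w|rewrite {1}IH /wstep /= /wout /= IH]. Qed.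

Lemma woutS w n : wout w n.+1 =
  maj (out (w1 w) (wout w) n) (out (w2 w) (wout w) n) (out (w3 w) (wout w) n).
Proof. by rewrite {1}/wout /= iter_wstep. Qed.

Definition wneg (w : wtree) : wtree :=
  WT (~~ wb w) (neg (w1 w)) (neg (w2 w)) (neg (w3 w)).

Lemma wout_neg w n : wout (wneg w) n = ~~ wout w n.
Proof.
rewrite /wout; have -> : iter n wstep (wneg w) = wneg (iter n wstep w); last by [].
by elim: n => //= n ->; rewrite /wstep /wneg /= !root_neg maj_neg !step_neg.
Qed.

Lemma bool_flip (a b : bool) : a <> b -> (~~ a /\ b) \/ (~~ ~~ a /\ ~~ b).
Proof. by case: a b => [] [] // _; [right|left]. Qed.

Lemma state_flips t z T : state t z T <> state t z T.+2 ->
  flips T t z \/ flips T (neg t) (fun n => ~~ z n).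
Proof.
elim: t z => [b|b l IHl r IHr] z.
  rewrite !state_Lf => H; have {}H : out (Lf b) z T <> out (Lf b) z T.+2 by congruence.
  have [?|?] := bool_flip H; first by left; left.
  by right; left; rewrite /flip !(out_neg (Lf b)).
rewrite !state_Nd; set w := out (Nd b l r) z => H.
have Ew n : out (neg (Nd b l r)) (fun n => ~~ z n) n = ~~ w n by rewrite out_neg.
have Ewf : out (neg (Nd b l r)) (fun n => ~~ z n) = (fun n => ~~ w n).
  by apply: functional_extensionality_dep.
case: (pselect (w T = w T.+2)) => [Ew2|/bool_flip[?|?]]; last 2 first.
- by left; left.
- by right; left; rewrite /flip !Ew.
case: (pselect (state l w T = state l w T.+2)) => [El|/IHl[?|?]]; last 2 first.
- by left; right; left.
- by right; right; left; rewrite Ewf.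
case: (pselect (state r w T = state r w T.+2)) => [Er|/IHr[?|?]]; last 2 first.
- by left; right; right.
- by right; right; right; rewrite Ewf.
by case: H; rewrite Ew2 El Er.
Qed.

Definition WApex (N k : nat) (w : wtree) : Prop :=
  [\/ HasApex N k (w1 w), HasApex N k (w2 w) | HasApex N k (w3 w)] \/
  [\/ Apex N k (w1 w) (w2 w), Apex N k (w1 w) (w3 w) | Apex N k (w2 w) (w3 w)].

Lemma perf_neg k t : perf k t -> perf k (neg t).
Proof. by elim: k t => [|k IH] [b|b l r] //= [? ?]; split; exact: IH. Qed.

(** The trace only treats flips from - to +; a change from + to - is such a flip in the negated
    configuration. *)
Lemma unstable_WApex N k T w : 0 < N -> N + 5 <= T ->
  perf k (w1 w) -> perf k (w2 w) -> perf k (w3 w) ->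
  iter T wstep w <> iter T.+2 wstep w -> WApex N k w \/ WApex N k (wneg w).
Proof.
move=> N0 le p1 p2 p3; rewrite !iter_wstep => H.
have Ef : wout (wneg w) = (fun n => ~~ wout w n).
  by apply: functional_extensionality_dep => n; exact: wout_neg.
have main : [\/ flip (wout w) T, flips T (w1 w) (wout w), flips T (w2 w) (wout w) |
      flips T (w3 w) (wout w)] \/
    [\/ flip (wout (wneg w)) T, flips T (w1 (wneg w)) (wout (wneg w)),
        flips T (w2 (wneg w)) (wout (wneg w)) | flips T (w3 (wneg w)) (wout (wneg w))].
  rewrite Ef.
  case: (pselect (wout w T = wout w T.+2)) => [E0|/bool_flip[?|?]]; last 2 first.
  - by left; constructor 1.
  - by right; constructor 1.
  case: (pselect (state (w1 w) (wout w) T = state (w1 w) (wout w) T.+2)) => [E1|/state_flips[?|?]]; last 2 first.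
  - by left; constructor 2.
  - by right; constructor 2.
  case: (pselect (state (w2 w) (wout w) T = state (w2 w) (wout w) T.+2)) => [E2|/state_flips[?|?]]; last 2 first.
  - by left; constructor 3.
  - by right; constructor 3.
  case: (pselect (state (w3 w) (wout w) T = state (w3 w) (wout w) T.+2)) => [E3|/state_flips[?|?]]; last 2 first.
  - by left; constructor 4.
  - by right; constructor 4.
  by case: H; rewrite E0 E1 E2 E3.
case: main => H'; [left|right]; apply: (trace_root N0 _ _ _ le (woutS _) H') => //.
- exact: perf_neg.
- exact: perf_neg.
- exact: perf_neg.
Qed.

Section WholeProb.

Variable R : realFieldType.
Local Open Scope ring_scope.
Local Notation prob := (@prob R).

Lemma prob_exists (T I : finType) (E : I -> T -> Prop) (c : R) :
  (forall i, prob (E i) <= c) -> prob (fun x => exists i, E i x) <= #|I|%:R * c.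
Proof.
move=> H; rewrite -sum1_card natr_sum mulr_suml.
have -> : prob (fun x => exists i, E i x) = prob (fun x => exists2 i, i \in index_enum I & E i x).
  by apply: prob_ext => x; split => [[i Ei]|[i _ Ei]]; exists i; rewrite ?mem_index_enum.
elim: (index_enum I) => [|i s IH].
  rewrite big_nil; apply: (@le_trans _ _ (prob (fun _ : T => False))).
    by apply: prob_le => x [].
  rewrite /prob (_ : [set x | _] = set0) ?cards0 ?mul0r //.
  by apply/setP => x; rewrite !inE; apply/asboolP.
rewrite big_cons (_ : (i \in I) = true) // mul1r; rewrite mul1r in IH.
apply: le_trans (lerD (H i) IH).
apply: le_trans (probU R (E i) (fun x => exists2 j, j \in s & E j x)).
apply: prob_le => x [j].
by rewrite inE => /orP[/eqP ->|js]; [left|right; exists j].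
Qed.

(** There are N + 1 divisions of N between the legs and 4 pairs of parities; 100 bounds the product
    of the two initial weights. *)
Definition apex_bound (N : nat) : R := (4 * N.+1)%:R * (100 * chain_rate R ^+ N).

Lemma chain_rate_gt0 : 0 < chain_rate R. Proof. by rewrite /chain_rate; lra. Qed.

Lemma apex_bound_ge0 N : 0 <= apex_bound N.
Proof. by rewrite mulr_ge0 ?ler0n // mulr_ge0 ?exprn_ge0 ?ltW ?chain_rate_gt0 //; lra. Qed.

Lemma prob_Apex N k :
  prob (fun x : PT k * PT k => Apex N k (emb x.1) (emb x.2)) <= apex_bound N.
Proof.
pose E (i : 'I_N.+1 * (bool * bool)) (x : PT k * PT k) : Prop :=
  [/\ (i.1.+2 <= k)%N, ((N - i.1).+2 <= k)%N &
      Chain i.1 KB i.2.1 (emb x.1) /\ Chain (N - i.1) KB i.2.2 (emb x.2)].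
apply: (@le_trans _ _ (prob (fun x => exists i, E i x))).
  apply: prob_le => x [na [nc [pa [pc [sN ka kc ca cc]]]]].
  have lt : (na < N.+1)%N by lia.
  exists (Ordinal lt, (pa, pc)); rewrite /E /=.
  by have -> : (N - na)%N = nc by lia.
rewrite /apex_bound (_ : 4 * N.+1 = #|{: 'I_N.+1 * (bool * bool)}|)%N; last first.
  by rewrite !card_prod card_ord card_bool mulnC.
apply: prob_exists => i.
case: (boolP ((i.1.+2 <= k)%N && ((N - i.1).+2 <= k)%N)) => [/andP[h1 h2]|h].
  have leN : (i.1 <= N)%N by rewrite -ltnS.
  have := Apex_chains_le R i.2.1 i.2.2 h1 h2; rewrite subnKC //; apply: le_trans.
  rewrite -probM; apply: prob_le => x; by case.
apply: (@le_trans _ _ (prob (fun _ : PT k * PT k => False))).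
  by apply: prob_le => x [h1 h2]; rewrite h1 h2 in h.
rewrite /prob (_ : [set x | _] = set0) ?cards0 ?mul0r.
  by rewrite mulr_ge0 ?exprn_ge0 ?ltW ?chain_rate_gt0 //; lra.
by apply/setP => x; rewrite !inE; apply/asboolP.
Qed.

Lemma HasApex_low N k t : (k.*2 <= N.+4)%N -> ~ HasApex N k t.
Proof.
elim: k t => [|k IH] t.
  by case: t => [b|b l r] _ [].
case: t => [b _ []|b l r le].
have lek : (k.*2 <= N.+4)%N by lia.
case=> [[na [nc [? [? [? ? ? _ _]]]]]|H|H]; [by lia|exact: (IH l)|exact: (IH r)].
Qed.

(** Adding [apex_bound N] turns the recursion x -> 2 x + A into doubling. It starts at height N/2 +
    2, below which an apex with legs of total length N does not fit; thus only about 2^(k - N/2)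
    vertices are counted. *)
Lemma prob_HasApex N k : ((N./2).+2 <= k)%N ->
  Pr R k (HasApex N k) + apex_bound N <= apex_bound N * 2 ^+ (k - (N./2).+2).
Proof.
move=> le; have [d ->] : exists d, k = (d + (N./2).+2)%N.
  by exists (k - (N./2).+2)%N; rewrite subnK.
rewrite addnK; elim: d {le} => [|d IH].
  rewrite add0n expr0 mulr1 (@PrF R _) ?add0r // => t _; apply: HasApex_low; lia.
rewrite addSn exprS; clear k; set k := (d + _)%N in IH *.
have H : Pr R k.+1 (HasApex N k.+1) <= apex_bound N + (Pr R k (HasApex N k) + Pr R k (HasApex N k)).
  apply: (@Pr_leU _ _ _ (fun t => if t is Nd b l r then Apex N k l r else False)
    (fun t => node (fun=> True) (HasApex N k) (fun=> True) t \/
              node (fun=> True) (fun=> True) (HasApex N k) t)).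
  - by case=> [//|b l r] _ [?|?|?]; [left|right; left|right; right].
  - have := prob_Apex N k; apply: le_trans.
    rewrite -[X in _ <= X]mul1r -(@probT R bool) ?card_bool // -probM.
    by apply: prob_le.
  - apply: le_trans (PrU _ _ _ _) _.
    by rewrite !Pr_nodeT (@PrT R k (fun=> True)) // mulr1 mul1r.
by have := apex_bound_ge0 N; lra.
Qed.

Definition WPT (h : nat) : finType := (bool * (PT h * (PT h * PT h)))%type.
Definition wemb (h : nat) (x : WPT h) : wtree :=
  WT x.1 (emb x.2.1) (emb x.2.2.1) (emb x.2.2.2).

Lemma prob_WApex N h : ((N./2).+2 <= h)%N ->
  prob (fun x : WPT h => WApex N h (wemb x)) <= 3 * (apex_bound N * 2 ^+ (h - (N./2).+2)).
Proof.
move=> le; apply: le_trans (_ : 3 * (Pr R h (HasApex N h) + apex_bound N) <= _); last first.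
  by rewrite ler_wpM2l ?prob_HasApex //; lra.
have c1 (E : PT h -> Prop) : prob (fun x : WPT h => E x.2.1) = prob E.
  by rewrite (prob_snd R (fun y => E y.1)) ?card_bool // prob_fst ?card_prod ?muln_gt0 ?card_PT_gt0.
have c23 (E : PT h * PT h -> Prop) : prob (fun x : WPT h => E x.2.2) = prob E.
  by rewrite (prob_snd R (fun y => E y.2)) ?card_bool // prob_snd ?card_PT_gt0.
have c2 (E : PT h -> Prop) : prob (fun x : WPT h => E x.2.2.1) = prob E.
  by rewrite (c23 (fun y => E y.1)) prob_fst ?card_PT_gt0.
have c3 (E : PT h -> Prop) : prob (fun x : WPT h => E x.2.2.2) = prob E.
  by rewrite (c23 (fun y => E y.2)) prob_snd ?card_PT_gt0.
have c12 (E : PT h * PT h -> Prop) : prob (fun x : WPT h => E (x.2.1, x.2.2.1)) = prob E.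
  pose f (x : WPT h) : (PT h * PT h) * (bool * PT h) := ((x.2.1, x.2.2.1), (x.1, x.2.2.2)).
  have bf : bijective f.
    by exists (fun y => (y.2.1, (y.1.1, (y.1.2, y.2.2)))); [case=> ? [? [? ?]]|case=> -[? ?] [? ?]].
  by rewrite (prob_bij R (fun y => E y.1) bf) prob_fst ?card_prod ?card_bool ?muln_gt0 ?card_PT_gt0.
have c13 (E : PT h * PT h -> Prop) : prob (fun x : WPT h => E (x.2.1, x.2.2.2)) = prob E.
  pose f (x : WPT h) : (PT h * PT h) * (bool * PT h) := ((x.2.1, x.2.2.2), (x.1, x.2.2.1)).
  have bf : bijective f.
    by exists (fun y => (y.2.1, (y.1.1, (y.2.2, y.1.2)))); [case=> ? [? [? ?]]|case=> -[? ?] [? ?]].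
  by rewrite (prob_bij R (fun y => E y.1) bf) prob_fst ?card_prod ?card_bool ?muln_gt0 ?card_PT_gt0.
have aH := prob_Apex N h.
have p0 (E F : WPT h -> Prop) (a b : R) : prob E <= a -> prob F <= b ->
    prob (fun x => E x \/ F x) <= a + b.
  by move=> Ea Fb; apply: le_trans (probU _ _ _) (lerD Ea Fb).
have A1 : prob (fun x : WPT h => HasApex N h (emb x.2.1)) <= Pr R h (HasApex N h).
  by rewrite (c1 (fun y => HasApex N h (emb y))).
have A2 : prob (fun x : WPT h => HasApex N h (emb x.2.2.1)) <= Pr R h (HasApex N h).
  by rewrite (c2 (fun y => HasApex N h (emb y))).
have A3 : prob (fun x : WPT h => HasApex N h (emb x.2.2.2)) <= Pr R h (HasApex N h).
  by rewrite (c3 (fun y => HasApex N h (emb y))).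
have A12 : prob (fun x : WPT h => Apex N h (emb x.2.1) (emb x.2.2.1)) <= apex_bound N.
  by rewrite (c12 (fun y => Apex N h (emb y.1) (emb y.2))).
have A13 : prob (fun x : WPT h => Apex N h (emb x.2.1) (emb x.2.2.2)) <= apex_bound N.
  by rewrite (c13 (fun y => Apex N h (emb y.1) (emb y.2))).
have A23 : prob (fun x : WPT h => Apex N h (emb x.2.2.1) (emb x.2.2.2)) <= apex_bound N.
  by rewrite (c23 (fun y => Apex N h (emb y.1) (emb y.2))).
have := p0 _ _ _ _ (p0 _ _ _ _ A1 (p0 _ _ _ _ A2 A3)) (p0 _ _ _ _ A12 (p0 _ _ _ _ A13 A23)).
move=> H; apply: le_trans (le_trans _ H) _; last by lra.
by apply: prob_le => x [[]|[]] ?; [left; left|left; right; left|left; right; right|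
  right; left|right; right; left|right; right; right].
Qed.

Lemma prob_WApex_neg N h :
  prob (fun x : WPT h => WApex N h (wneg (wemb x))) =
  prob (fun x : WPT h => WApex N h (wemb x)).
Proof.
pose ng (x : WPT h) : WPT h := (~~ x.1, (ngPT x.2.1, (ngPT x.2.2.1, ngPT x.2.2.2))).
have ngK : cancel ng ng by case=> ? [? [? ?]]; rewrite /ng /= negbK !ngPTK.
rewrite -(prob_bij R (fun x => WApex N h (wemb x)) (Bijective ngK ngK)).
by apply: prob_ext => x; rewrite /wemb /wneg /= !emb_ngPT.
Qed.

Lemma wemb_perf h (x : WPT h) :
  [/\ perf h (w1 (wemb x)), perf h (w2 (wemb x)) & perf h (w3 (wemb x))].
Proof. by split; exact: emb_perf. Qed.

Lemma prob_unstable N T h : (0 < N)%N -> (N + 5 <= T)%N -> ((N./2).+2 <= h)%N ->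
  prob (fun x : WPT h => iter T wstep (wemb x) <> iter T.+2 wstep (wemb x)) <=
  6 * (apex_bound N * 2 ^+ (h - (N./2).+2)).
Proof.
move=> N0 le lh; have H := prob_WApex lh.
apply: (@le_trans _ _ (prob (fun x : WPT h => WApex N h (wemb x) \/ WApex N h (wneg (wemb x))))).
  apply: prob_le => x; have [p1 p2 p3] := wemb_perf x.
  exact: unstable_WApex.
by apply: le_trans (probU _ _ _) _; rewrite prob_WApex_neg; lra.
Qed.

End WholeProb.

(** * Slow fronts *)

(* SB and SA: a parent in state + keeps the root + at all odd (resp. positive even)
   times; SBm: the same at odd times for a parent that is - at time 0. *)
Definition SB (t : tr) : Prop := forall n, odd n -> out t (fun=> true) n.
Definition SA (t : tr) : Prop := forall n, 0 < n -> ~~ odd n -> out t (fun=> true) n.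
Definition SBm (t : tr) : Prop := forall n, odd n -> out t (fun m => m != 0) n.

Lemma maj_two (a b : bool) c : a -> b -> maj a b c.
Proof. by move=> -> ->. Qed.

Lemma maj_13 (a b c : bool) : a -> c -> maj a b c.
Proof. by move=> -> ->; rewrite /maj orbT. Qed.

Lemma maj_23 (a b c : bool) : b -> c -> maj a b c.
Proof. by move=> -> ->; rewrite /maj !orbT. Qed.

Lemma SA_plus l r : SB l \/ SB r -> SA (Nd true l r).
Proof.
move=> H n _; elim/ltn_ind: n => -[//|n] IH on; rewrite outS_Nd; set w := out (Nd _ _ _) _.
have cw c : SB c -> out c w n.
  move=> Sc; rewrite (@out_eq _ _ (fun=> true)); first by apply: Sc; lia.
  by move=> m mn om /=; apply: IH; lia.
by case: H => /cw Hc; [apply: maj_two | apply: maj_13].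
Qed.

Lemma SA_minus l r : SBm l \/ SBm r -> SA (Nd false l r).
Proof.
move=> H n; elim/ltn_ind: n => -[//|n] IH _ on; rewrite outS_Nd; set w := out (Nd _ _ _) _.
have cw c : SBm c -> out c w n.
  move=> Sc; rewrite (@out_eq _ _ (fun m => m != 0)); first by apply: Sc; lia.
  by case=> [//|m] mn om /=; apply: IH; lia.
by case: H => /cw Hc; [apply: maj_two | apply: maj_13].
Qed.

(** One child in [SA] is enough: the vertex in + at odd times keeps it + at positive even times, and
    the child together with the input keeps the vertex +. *)
Lemma odd_plus b l r z (w := out (Nd b l r) z) :
  (forall n, 0 < n -> z n) -> w 1 -> SA l \/ SA r -> forall n, odd n -> w n.
Proof.
move=> zt u1 H n; elim/ltn_ind: n => -[//|[|n]] IH on //.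
rewrite /w outS_Nd -/w.
have cw c : SA c -> out c w n.+1.
  move=> Sc; rewrite (@out_eq _ _ (fun=> true)); first by apply: Sc; lia.
  by move=> m mn om /=; apply: IH; lia.
by case: H => /cw Hc; [apply: maj_two | apply: maj_13] => //; apply: zt.
Qed.

Lemma SBm_children b l r : root l = true -> root r = true -> SA l \/ SA r ->
  SBm (Nd b l r).
Proof.
move=> rl rr H n; apply: odd_plus => //; first by case.
by rewrite outS_Nd /out /= rl rr.
Qed.

Lemma SB_children b l r : root l = true \/ root r = true -> SA l \/ SA r ->
  SB (Nd b l r).
Proof.
move=> rt H n; apply: odd_plus => //.
by rewrite outS_Nd /out /= /maj; case: rt => ->; rewrite ?orbT.
Qed.

(** Time 1 is exempted, because a vertex is + at time 1 under a parent in - only if both children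
    start in +. This admits the trees of [QB_late]. *)
Definition QL (p : bool) (t : tr) : Prop :=
  forall n, 1 < n -> odd n = p -> out t (fun=> false) n.
Definition QB1 (t : tr) : Prop := forall n, odd n -> out t (fun=> false) n.

Lemma out_ge_false t z n : out t (fun=> false) n -> out t z n.
Proof. exact: out_mono. Qed.

Lemma QA_plus l r : SB l -> SB r -> QL false (Nd true l r).
Proof.
move=> Sl Sr n _; elim/ltn_ind: n => -[//|n] IH on; rewrite outS_Nd; set w := out (Nd _ _ _) _.
have cw c : SB c -> out c w n.
  move=> Sc; rewrite (@out_eq _ _ (fun=> true)); first by apply: Sc; lia.
  by move=> m mn om /=; apply: IH; lia.
by apply: maj_23; apply: cw.
Qed.

Lemma QA_minus b l r : QB1 l -> QB1 r -> QL false (Nd b l r).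
Proof.
move=> Ql Qr -[//|n] _ on; rewrite outS_Nd.
by apply: maj_23; apply: out_ge_false; [apply: Ql|apply: Qr]; lia.
Qed.

Lemma QB1_children b l r : root l = true -> root r = true -> SA l -> SA r ->
  QB1 (Nd b l r).
Proof.
move=> rl rr Sl Sr n; elim/ltn_ind: n => -[//|n] IH on; rewrite outS_Nd; set w := out (Nd _ _ _) _.
have cw c : root c = true -> SA c -> out c w n.
  case: n IH on => [|n] IH on rc Sc; first by [].
  rewrite (@out_eq _ _ (fun=> true)); first by apply: Sc; lia.
  by move=> m mn om /=; apply: IH; lia.
by apply: maj_23; apply: cw.
Qed.

Lemma QB_late b l r : QL false l -> QL false r -> QL true (Nd b l r).
Proof.
move=> Ql Qr -[//|n] n1 on; rewrite outS_Nd.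
by apply: maj_23; apply: out_ge_false; [apply: Ql|apply: Qr]; lia.
Qed.

(* A front reaching the root from below exactly at time n. *)
Definition UpE (n : nat) (t : tr) : Prop :=
  forall z m, m <= n -> ~~ odd (m + n) ->
    (forall s, s < m -> odd (s + m) -> ~~ z s) -> out t z m = (m == n).

Lemma UpE0 t : root t = true -> UpE 0 t.
Proof. by move=> rt z [|m] //. Qed.

(** Until the front arrives, the parent and the path child are both -, which outvotes the off-path
    child. That child is + at time [n] for every input, by monotonicity. An initial state matters
    only for vertices observed at even times. *)
Lemma UpE_step n d t : isNd t -> (~~ odd n.+1 -> root t = false) ->
  UpE n (child d t) -> out (child (~~ d) t) (fun=> false) n -> UpE n.+1 t.
Proof.
move=> nd rt up q z m; elim/ltn_ind: m => -[|m] IH le om zf.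
  by rewrite [LHS](rt _) //; rewrite add0n in om.
rewrite (outS_child d _ _ nd) (negbTE (zf m _ _)) //; last by lia.
have lm : out (child d t) (out t z) m = (m == n).
  apply: up; [by lia|by lia|] => s sm os.
  rewrite IH; [by lia|by lia|by lia|by lia|] => s' ss os'.
  by apply: zf; lia.
rewrite lm eqSS; case: eqP => [->|_]; last by rewrite /maj /=; case: (out _ _ _).
by apply: maj_23 => //; apply: out_ge_false.
Qed.

(* The subtree waits in state - and, once its input becomes + at time tau,
   transmits the front downwards for m steps. *)
Definition DnE (p : bool) (m : nat) (t : tr) : Prop :=
  (forall z n, odd n = ~~ p -> (forall s, s < n -> odd (s + n) -> ~~ z s) ->
     ~~ out t z n) /\
  (forall z tau, 2 < tau -> odd tau = p ->
     (forall s, s < tau -> ~~ odd (s + tau) -> ~~ z s) -> z tau ->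
     m = 0 \/ state t z (tau + m).-2 <> state t z (tau + m)).

(** The off-path child is + at [tau] for every input, so the vertex follows its parent at once;
    before that the path child and the parent hold it in -. *)
Lemma DnE_step (p : bool) m d t : isNd t -> (p -> root t = false) ->
  DnE (~~ p) m (child d t) -> QL p (child (~~ d) t) -> DnE p m.+1 t.
Proof.
move=> nd rt [D1 D2] q.
have W1 z n : odd n = ~~ p -> (forall s, s < n -> odd (s + n) -> ~~ z s) -> ~~ out t z n.
  elim/ltn_ind: n => -[|n] IH on zf.
    by rewrite [out _ _ _]rt //; case: (p) on.
  rewrite (outS_child d _ _ nd) (negbTE (zf n _ _)) //; last by lia.
  have : ~~ out (child d t) (out t z) n.
    apply: D1; first by move: on => /=; case: (p); case: (odd n).
    move=> s sn os; apply: IH; [by lia| |].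
      by move: on os; rewrite oddD /=; case: (odd n); case: (odd s); case: (p).
    by move=> s' ss os'; apply: zf; lia.
  by move=> /negbTE ->; rewrite /maj /= andbF.
split=> // z tau tau2 otau zf zt.
set w := out t z.
have wt : w tau.+1.
  rewrite /w (outS_child d _ _ nd) -/w zt; apply: maj_13 => //.
  by apply: out_ge_false; apply: q => //; lia.
have wf s : s < tau.+1 -> ~~ odd (s + tau.+1) -> ~~ w s.
  move=> st os; apply: W1.
    by move: os otau; rewrite oddD /=; case: (odd s); case: (odd tau); case: (p).
  by move=> s' ss os'; apply: zf; lia.
right; have [] := D2 w tau.+1 (ltnW tau2) _ wf wt.
- by rewrite /= otau.
(* With no further level to transmit to, the change is visible at the vertex itself. *)
- move=> ->; rewrite addn1 => E.
  have w0 : ~~ w tau.-1 by apply: wf; lia.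
  have Ew : w tau.+1 = w tau.-1 by exact: (congr1 root (esym E)).
  by move: wt; rewrite Ew (negbTE w0).
- rewrite addnS -addSn; case: t nd {D1 D2 q rt W1} @w wt wf => // b l r _ w wt wf.
  rewrite !state_Nd -/w; move=> H [_ El Er]; apply: H.
  by case: d.
Qed.

(** After negation, [SA] says that a parent in - keeps the root - at all positive even times. *)
Lemma DnE0_A t : root (neg t) = true -> SA (neg t) -> DnE true 0 t.
Proof.
move=> rt S; split; last by left.
move=> z [|n] on zf; first by move: rt; rewrite root_neg => ->.
rewrite (@out_eq _ _ (fun=> false)); last by move=> m mn om; apply/negbTE/zf.
by rewrite -(out_neg t (fun=> false)) S // on.
Qed.

(** The universal quantifier over inputs makes blocks in disjoint subtrees independent of one
    another and of the tree above them. *)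
Definition Blk (T : nat) (t : tr) : Prop :=
  forall z, state t z T.-2 <> state t z T.

(* Once x and its parent y are + in their parity classes, their other subtrees
   keep them + for ever, so that the front passes from the left to the right
   subtree of u. *)
Lemma block_unstable n m T b0 b1 L Rr A B :
  T = n.+1 + m -> ~~ odd n -> 1 < n -> 0 < m ->
  UpE n L -> DnE true m Rr -> SB A -> root B = true -> SA B ->
  Blk T (Nd b0 (Nd true (Nd b1 L Rr) A) B).
Proof.
move=> ET on n1 m0 up [D1 D2] SA_ rB SB_ z.
set u := Nd b1 L Rr; set x := Nd true u A; set y := Nd b0 x B.
set wy := out y z; set wx := out x wy; set wu := out u wx.
have xy t : (~~ odd t -> wx t) /\ (odd t -> wy t).
  elim/ltn_ind: t => -[//|t] IH; split => /= ot.
    rewrite /wx /x outS_Nd -/x -/wx; apply: maj_13; first by apply: (IH t _).2 => //; rewrite -[odd t]negbK.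
    rewrite (@out_eq _ _ (fun=> true)); first by apply: SA_; rewrite -[odd t]negbK.
    by move=> s st os /=; apply: (IH s _).1; [lia|move: os ot; rewrite oddD; case: (odd s); case: (odd t)].
  rewrite /wy /y outS_Nd -/y -/wy -/wx; apply: maj_23; first by apply: (IH t _).1.
  case: t IH ot => // t IH ot; rewrite (@out_eq _ _ (fun=> true)); first by apply: SB_.
  by move=> s st os /=; apply: (IH s _).2; [lia|move: os ot; rewrite oddD /=; case: (odd s); case: (odd t)].
(* Before time [n] both children of [u] are - at even times and outvote the permanent + of [x]. At
   time [n] the left child joins [x], and the front crosses [u]. *)
have dyn t : wu t.+1 = maj (wx t) (out L wu t) (out Rr wu t) by rewrite /wu /u outS_Nd.
have wuf t : t < n -> odd t -> ~~ wu t.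
  elim/ltn_ind: t => -[//|t] IH tn /= ot.
  have below s : s < t -> odd (s + t) -> ~~ wu s.
    move=> st os; apply: IH; [lia|lia|].
    by move: os ot; rewrite oddD; case: (odd s); case: (odd t).
  rewrite dyn (up wu t) //; [|by lia|by rewrite oddD (negbTE ot) (negbTE on)].
  have -> : (t == n) = false by lia.
  rewrite (negbTE (D1 wu t _ _)) //; first by case: (wx t).
  by rewrite (negbTE ot).
have wun : wu n.+1.
  rewrite dyn (up wu n) // ?eqxx; last 2 first.
  - by rewrite oddD (negbTE on).
  - by move=> s sn os; apply: wuf => //; move: os; rewrite oddD (negbTE on) addbF.
  by apply: maj_two => //; apply: (xy n).1.
have [|//|s st os|//||] := D2 wu n.+1; first by lia.
- move: os; rewrite oddD /= (negbTE on) /= addbT negbK => os.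
  by apply: wuf => //; move: st os; rewrite ltnS leq_eqVlt => /orP[/eqP ->|//]; rewrite (negbTE on).
- by lia.
rewrite -ET => H E; apply: H; move: E; rewrite /y state_Nd -/y -/wy [RHS]state_Nd -/y -/wy.
move=> [_ E _]; move: E; rewrite /x state_Nd -/x -/wx [RHS]state_Nd -/x -/wx.
move=> [_ E _]; move: E; rewrite /u state_Nd -/u -/wu [RHS]state_Nd -/u -/wu.
by case.
Qed.

(** * Recursive bounds for self-supporting subtrees *)

Section LowerProb.

Variable R : realFieldType.
Local Open Scope ring_scope.
Local Notation Pr := (@Pr R).

Let np k := Pr k (fun t => root t = true /\ ~ SA t).
Let nm k := Pr k (fun t => root t = false /\ ~ SA t).

Lemma SA_Lf b : SA (Lf b). Proof. by case=> // n; rewrite outS_Lf. Qed.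

Lemma Pr_SB0 : Pr 0 SB = 1.
Proof. by apply: PrT => -[b _|//]; case=> // n; rewrite outS_Lf. Qed.

Lemma np0 : np 0 = 0.
Proof. by apply: PrF => -[b|//] _ [_]; apply; exact: SA_Lf. Qed.

Lemma npS k : np k.+1 <= 1 / 2 * ((1 - Pr k SB) * (1 - Pr k SB)).
Proof.
rewrite -PrC -(Pr_nodeb R k true); apply: Pr_le => -[//|b l r] _ /= [-> nS].
by split => // S; apply: nS; apply: SA_plus; [left|right].
Qed.

Lemma nmS k : nm k.+1 <= 1 / 2 * ((1 - Pr k SBm) * (1 - Pr k SBm)).
Proof.
rewrite -PrC -(Pr_nodeb R k false); apply: Pr_le => -[//|b l r] _ /= [-> nS].
by split => // S; apply: nS; apply: SA_minus; [left|right].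
Qed.

Lemma smS k : 1 / 4 <= Pr k.+1 SBm + np k * np k.
Proof.
have -> : 1 / 4 = Pr k.+1 (node (fun=> True) (fun t => root t = true) (fun t => root t = true)).
  by rewrite Pr_nodeT !Pr_root; field.
apply: (@Pr_leU _ _ _ SBm (node (fun=> True) (fun t => root t = true /\ ~ SA t)
   (fun t => root t = true /\ ~ SA t))) => //; last by rewrite Pr_nodeT.
case=> [//|b l r] _ [_ rl rr].
case: (pselect (SA l)) => [Sl|nl]; first by left; apply: SBm_children => //; left.
case: (pselect (SA r)) => [Sr|nr]; first by left; apply: SBm_children => //; right.
by right.
Qed.

Lemma sS k : 3 / 4 - (np k * np k + 2 * (np k * nm k)) <= Pr k.+1 SB.
Proof.
have : Pr k.+1 (fun t => ~ SB t) <= 1 / 2 * (1 / 2) +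
    (np k * np k + (np k * nm k + nm k * np k)).
  pose NP t := root t = true /\ ~ SA t; pose NM t := root t = false /\ ~ SA t.
  apply: (@Pr_leU _ _ _ (node (fun=> True) (fun t => root t = false) (fun t => root t = false))
     (fun t => node (fun=> True) NP NP t \/ (node (fun=> True) NP NM t \/
        node (fun=> True) NM NP t))).
  - case=> [//|b l r] _ nS; case rl: (root l); last first.
      case rr: (root r); last by left.
      right; right; right; split => //; split => // S; apply: nS; apply: SB_children; by [right|left|right; right].
    have nl : ~ SA l by move=> S; apply: nS; apply: SB_children; left.
    have nr : ~ SA r by move=> S; apply: nS; apply: SB_children; [left|right].
    by right; case rr: (root r); [left|right; left].
  - by rewrite Pr_nodeT !Pr_root.
  - apply: le_trans (PrU _ _ _ _) (lerD _ _); first by rewrite Pr_nodeT.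
    by apply: le_trans (PrU _ _ _ _) (lerD _ _); rewrite Pr_nodeT.
rewrite PrC [nm k * _]mulrC; lra.
Qed.

(* s0 and m0 bound P(SB) and P(SBm) from below, cp and cm bound the probabilities
   of not SA with a root + or - from above; the hypotheses say that these bounds
   pass from the children to the parent. *)
Section Invariant.

Variables s0 m0 cp cm : R.
Hypotheses (cp0 : 0 <= cp) (cm0 : 0 <= cm) (s01 : s0 <= 3 / 4) (m01 : m0 <= 1).
Hypothesis Hcp : 1 / 2 * ((1 - s0) * (1 - s0)) <= cp.
Hypothesis Hcm : 1 / 2 * ((1 - m0) * (1 - m0)) <= cm.
Hypothesis Hm0 : m0 + cp * cp <= 1 / 4.
Hypothesis Hs0 : s0 + (cp * cp + 2 * (cp * cm)) <= 3 / 4.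

(** The product is again carried because of small heights: [SBm] fails at a leaf, so [nm 1] is 1/2
    and may exceed [cm], but [np 1] vanishes. *)
Lemma lower_S k :
  [/\ s0 <= Pr k SB, np k <= cp, np k * nm k <= cp * cm &
      (0 < k)%N -> m0 <= Pr k SBm].
Proof.
elim: k => [|k [hs hp hpm hm]].
  rewrite Pr_SB0 np0 mul0r mulr_ge0 //; split => //.
  by apply: le_trans s01 _; lra.
have h1 := s01; have h2 := m01; have h3 := Hm0; have h4 := Hs0.
have np_ge0 : 0 <= np k by exact: Pr_ge0.
have s1 := Pr_le1 R k SB.
have hp1 : np k.+1 <= cp.
  apply: le_trans (npS k) (le_trans _ Hcp).
  by rewrite ler_wpM2l ?ler_pM //; lra.
have pp : np k * np k <= cp * cp by rewrite ler_pM.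
split=> //.
- by have := sS k; lra.
- case: k hm {hs hp hpm s1 np_ge0 pp} hp1 => [|k] hm hp1.
    have : np 1 <= 0 by have := npS 0; rewrite Pr_SB0 subrr mul0r mulr0.
    move=> n0; have -> : np 1 = 0 by apply/le_anti; rewrite n0 Pr_ge0.
    by rewrite mul0r mulr_ge0.
  rewrite ler_pM ?Pr_ge0 //; apply: le_trans (nmS _) (le_trans _ Hcm).
  have := hm isT => {}hm; have := Pr_le1 R k.+1 SBm => s1.
  by rewrite ler_wpM2l ?ler_pM //; lra.
- by move=> _; have := smS k; lra.
Qed.

Lemma SA_plus_ge k : 1 / 2 - cp <= Pr k (fun t => root t = true /\ SA t).
Proof.
have [_ hp _ _] := lower_S k.
have : Pr k (fun t => root t = true) <= Pr k (fun t => root t = true /\ SA t) + np k.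
  apply: (@Pr_leU _ _ _ (fun t => root t = true /\ SA t)
    (fun t => root t = true /\ ~ SA t)) => // t _ rt.
  by case: (pselect (SA t)); [left|right].
by rewrite Pr_root; lra.
Qed.

Hypotheses (s0_ge0 : 0 <= s0) (a0 : 0 <= 1 / 2 - cp).
Let a := 1 / 2 - cp.
Let ha : 0 <= a := a0.
Let half0 : 0 <= 1 / 2 :> R. Proof. lra. Qed.

Lemma QB1_ge k : a * a <= Pr k.+1 QB1.
Proof.
apply: (@le_trans _ _ (Pr k.+1 (node (fun=> True) (fun t => root t = true /\ SA t)
   (fun t => root t = true /\ SA t)))).
  by rewrite Pr_nodeT ler_pM ?SA_plus_ge.
by apply: Pr_le => -[//|b l r] _ [_ [? ?] [? ?]]; exact: QB1_children.
Qed.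

Lemma QA_plus_ge k : 1 / 2 * (s0 * s0) <= Pr k.+1 (fun t => root t = true /\ QL false t).
Proof.
have [hs _ _ _] := lower_S k.
apply: (@le_trans _ _ (Pr k.+1 (node (eq^~ true) SB SB))).
  by rewrite Pr_nodeb ler_wpM2l ?ler_pM.
by apply: Pr_le => -[//|b l r] _ [-> ? ?]; split => //; exact: QA_plus.
Qed.

Lemma QA_minus_ge k : 1 / 2 * (a * a * (a * a)) <= Pr k.+2 (fun t => root t = false /\ QL false t).
Proof.
apply: (@le_trans _ _ (Pr k.+2 (node (eq^~ false) QB1 QB1))).
  by rewrite Pr_nodeb ler_wpM2l // ler_pM ?QB1_ge ?mulr_ge0.
by apply: Pr_le => -[//|b l r] _ [-> ? ?]; split => //; exact: QA_minus.
Qed.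

Let ap := 1 / 2 * (s0 * s0).
Let am := 1 / 2 * (a * a * (a * a)).

Lemma QLA_ge k : ap + am <= Pr k.+2 (QL false).
Proof.
apply: (le_trans (lerD (QA_plus_ge k.+1) (QA_minus_ge k))).
rewrite -PrU_disj; last by move=> t _ [-> _] [].
by apply: Pr_le => t _ [[_ ?]|[_ ?]].
Qed.

(** The second summand, from [QB_late], is small but decisive: with [a * a] alone the constants of
    [lower_Q] would give a product q_A q_B below 1/16. *)
Lemma QLB_ge k : a * a + (ap * am + am * ap) <= Pr k.+3 (QL true).
Proof.
have ap0 : 0 <= ap by apply: mulr_ge0 => //; apply: mulr_ge0.
have am0 : 0 <= am by apply: mulr_ge0 => //; apply: mulr_ge0; apply: mulr_ge0.
pose S t := root t = true /\ SA t.
pose P t := root t = true /\ QL false t; pose M t := root t = false /\ QL false t.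
apply: (@le_trans _ _ (Pr k.+3 (fun t => node (fun=> True) S S t \/
   (node (fun=> True) P M t \/ node (fun=> True) M P t)))).
  rewrite !PrU_disj ?Pr_nodeT.
  - apply: lerD; first by apply: ler_pM => //; exact: SA_plus_ge.
    by apply: lerD; apply: ler_pM => //; do [exact: QA_plus_ge|exact: QA_minus_ge].
  - by case=> [//|b l r] _ [_ [rl _] [rr _]] [_ [rl' _] [rr' _]]; rewrite rl in rl'.
  - by case=> [//|b l r] _ [_ [rl _] [rr _]] [] [_ [rl' _] [rr' _]]; congruence.
apply: Pr_le => -[//|b l r] _ [[_ [? ?] [? ?]]|[] [_ [_ ?] [_ ?]]].
- by move=> n _ on; apply: QB1_children.
- exact: QB_late.
- exact: QB_late.
Qed.

End Invariant.

(** Rounded down so that 16 [qA] [qB] = 1.026 still exceeds 1. *)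
Definition qA : R := 57 / 200.
Definition qB : R := 9 / 40.

Lemma lower_Q k :
  [/\ qA <= Pr k.+3 (QL false), qB <= Pr k.+3 (QL true),
      1 / 5 <= Pr k.+1 QB1, 2 / 5 <= Pr k (fun t => root t = true /\ SA t) &
      1 / 2 <= Pr k SB].
Proof.
(* The values of [cp] and [cm] give equality in [H1] and [H2]; [s0] and [m0] are round values for
   which [H3] and [H4] hold with little room. *)
pose s0 : R := 29 / 40; pose m0 : R := 31 / 125.
pose cp : R := 1 / 2 * ((11 / 40) * (11 / 40)).
pose cm : R := 1 / 2 * ((94 / 125) * (94 / 125)).
have cp0 : 0 <= cp by rewrite /cp; lra.
have cm0 : 0 <= cm by rewrite /cm; lra.
have s01 : s0 <= 3 / 4 by rewrite /s0; lra.
have m01 : m0 <= 1 by rewrite /m0; lra.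
have H1 : 1 / 2 * ((1 - s0) * (1 - s0)) <= cp by rewrite /s0 /cp; lra.
have H2 : 1 / 2 * ((1 - m0) * (1 - m0)) <= cm by rewrite /m0 /cm; lra.
have H3 : m0 + cp * cp <= 1 / 4 by rewrite /m0 /cp; lra.
have H4 : s0 + (cp * cp + 2 * (cp * cm)) <= 3 / 4 by rewrite /s0 /cp /cm; lra.
have s00 : 0 <= s0 by rewrite /s0; lra.
have a0 : 0 <= 1 / 2 - cp by rewrite /cp; lra.
have a1 : 23 / 50 <= 1 / 2 - cp by rewrite /cp; lra.
have a2 : 213 / 1000 <= (1 / 2 - cp) * (1 / 2 - cp) by rewrite /cp; lra.
split.
- apply: le_trans (QLA_ge cp0 cm0 s01 m01 H1 H2 H3 H4 s00 a0 k.+1).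
  by rewrite /s0 /cp /qA; lra.
- apply: le_trans (QLB_ge cp0 cm0 s01 m01 H1 H2 H3 H4 s00 a0 k).
  by rewrite /s0 /cp /qB; lra.
- apply: le_trans (QB1_ge cp0 cm0 s01 m01 H1 H2 H3 H4 a0 k).
  by clear -a2; lra.
- apply: le_trans (SA_plus_ge cp0 cm0 s01 m01 H1 H2 H3 H4 k).
  by clear -a1; lra.
- have [hs _ _ _] := lower_S cp0 cm0 s01 m01 H1 H2 H3 H4 k.
  by apply: le_trans hs; rewrite /s0; lra.
Qed.

End LowerProb.

(** * Probability of fronts and of blocks *)

Section Blocks.

Variable R : realFieldType.
Local Open Scope ring_scope.
Local Notation Pr := (@Pr R).
Local Notation qA := (qA R).
Local Notation qB := (qB R).

Lemma qA_gt0 : 0 < qA. Proof. by rewrite /qA; lra. Qed.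
Lemma qB_gt0 : 0 < qB. Proof. by rewrite /qB; lra. Qed.

Let q (p : bool) : R := if p then qB else qA.

Lemma QL_ge p k : q p <= Pr k.+3 (QL p).
Proof. by have [? ? _ _ _] := lower_Q R k; case: p. Qed.

Lemma node_sym_ge k (B : bool -> Prop) (E F : tr -> Prop) :
  (forall t, perf k t -> E t -> F t -> False) ->
  Pr k.+1 (fun t => node B E F t \/ node B F E t) = 2 * (prob R B * (Pr k E * Pr k F)).
Proof.
move=> H; rewrite PrU_disj; last first.
  by case=> [//|b l r] [pl pr] [_ El Fr] [_ Fl Er]; exact: (H l).
by rewrite !Pr_node [Pr k F * _]mulrC mulr_natl mulr2n.
Qed.

(** A crude start along one fixed path, since the two directions exclude each other only for
    [n > 3]. It is used at [n = 6], so the loss is a constant. *)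
Lemma UpE_init n k : (n + 3 <= k)%N -> (1 / 10) ^+ n.+1 <= Pr k (UpE n).
Proof.
elim: n k => [|n IH] k le.
  apply: (@le_trans _ _ (1 / 2)); first by rewrite expr1; lra.
  by rewrite -(Pr_root R k true); apply: Pr_le => t _; exact: UpE0.
have [j Ej] : exists j, k = j.+4 by exists (k - 4)%N; lia.
subst k.
apply: (@le_trans _ _ (Pr j.+4 (node (eq^~ false) (UpE n) (fun t => out t (fun=> false) n)))).
  have h : 1 / 5 <= Pr j.+3 (fun t => out t (fun=> false) n).
    have [hA hB h1 _ _] := lower_Q R j; have [_ _ h2 _ _] := lower_Q R j.+2.
    case: n {IH le} => [|[|n]].
    - by apply: (@le_trans _ _ (1 / 2)); [lra|rewrite -(Pr_root R j.+3 true)].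
    - by apply: le_trans h2 _; apply: Pr_le => t _; apply.
    - apply: (@le_trans _ _ (q (odd n.+2))); first by rewrite /q /qA /qB; case: (odd _); lra.
      by apply: le_trans (QL_ge _ _) _; apply: Pr_le => t _; apply.
  rewrite Pr_nodeb exprS.
  have h' : (1 / 10) ^+ n.+1 <= Pr j.+3 (UpE n) by apply: IH; lia.
  have p0 : 0 <= (1 / 10) ^+ n.+1 :> R by rewrite exprn_ge0 //; lra.
  have h2 : (1 / 10) ^+ n.+1 * (1 / 5) <= Pr j.+3 (UpE n) * Pr j.+3 (fun t => out t (fun=> false) n).
    by rewrite ler_pM //; lra.
  lra.
by apply: Pr_le => -[//|b l r] _ [-> up qq]; apply: (@UpE_step n false).
Qed.

(** At time [n - 2] the front has not arrived, but [QL] already makes the root +. *)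
Lemma UpE_QL_disj n t : (3 < n)%N -> UpE n t -> QL (odd n) t -> False.
Proof.
move=> n4 up ql.
have : out t (fun=> false) n.-2 = (n.-2 == n) by apply: up => //; lia.
by rewrite ql; lia.
Qed.

(** Two levels at a time, because the types alternate: a vertex observed at odd times has a type A
    off-path child, factor 2 [qA]; one observed at even times must also start in -, factor 2 (1/2)
    [qB]. *)
Lemma UpE_double n k : (3 < n)%N -> ~~ odd n ->
  2 * (qA * qB) * Pr k.+3 (UpE n) <= Pr k.+4.+1 (UpE n.+2).
Proof.
move=> n4 on.
have s1 : 2 * (Pr k.+3 (UpE n) * qA) <= Pr k.+4 (UpE n.+1).
  apply: (@le_trans _ _ (Pr k.+4 (fun t => node (fun=> True) (UpE n) (QL false) t \/
      node (fun=> True) (QL false) (UpE n) t))).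
    rewrite node_sym_ge; last first.
      by move=> t _ up; rewrite -(negbTE on); exact: UpE_QL_disj.
    rewrite probT ?card_bool // mul1r ler_wpM2l ?ler_wpM2l ?Pr_ge0 ?(QL_ge false) //.
  apply: Pr_le => -[//|b l r] _ [] [_ h1 h2].
    by apply: (@UpE_step n false) => //=; [rewrite on|apply: h2 => //; lia].
  by apply: (@UpE_step n true) => //=; [rewrite on|apply: h1 => //; lia].
have s2 : 2 * (1 / 2 * (Pr k.+4 (UpE n.+1) * qB)) <= Pr k.+4.+1 (UpE n.+2).
  apply: (@le_trans _ _ (Pr k.+4.+1 (fun t => node (eq^~ false) (UpE n.+1) (QL true) t \/
      node (eq^~ false) (QL true) (UpE n.+1) t))).
    rewrite node_sym_ge; last first.
      move=> t _ up h; apply: (@UpE_QL_disj n.+1 t) => //; first by lia.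
      by rewrite /= on.
    by rewrite prob_bool !ler_wpM2l ?Pr_ge0 ?(QL_ge true) //; lra.
  apply: Pr_le => -[//|b l r] _ [] [-> h1 h2].
    by apply: (@UpE_step n.+1 false) => //=; apply: h2; [lia|rewrite /= on].
  by apply: (@UpE_step n.+1 true) => //=; apply: h1; [lia|rewrite /= on].
have := ler_wpM2r (ltW qB_gt0) s1; lra.
Qed.

Definition front_rate : R := 2 * (qA * qB).

Lemma front_rate_ge0 : 0 <= front_rate.
Proof.
by apply: mulr_ge0 => //; apply: mulr_ge0; apply: ltW; [exact: qA_gt0|exact: qB_gt0].
Qed.

Lemma UpE_ge j k : (j.*2 + 9 <= k)%N -> (1 / 10) ^+ 7 * front_rate ^+ j <= Pr k (UpE (j.*2 + 6)).
Proof.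
elim: j k => [|j IH] k le; first by rewrite expr0 mulr1; apply: UpE_init.
have [i Ei] : exists i, k = i.+4.+1 by exists (k - 5)%N; lia.
subst k; rewrite doubleS !addSn; apply: le_trans (UpE_double _ _ _); [|lia|lia].
rewrite [front_rate ^+ _]exprS mulrCA -/front_rate ler_wpM2l ?front_rate_ge0 // IH //; lia.
Qed.

Lemma DnE_QL_disj p m t : DnE (~~ p) m t -> QL p t -> False.
Proof.
move=> [D1 _] ql; have := D1 (fun=> false) (if p then 3 else 2)%N.
rewrite ql; [|by case: p {D1 ql}..].
by move=> /(_ _ _)/wrap[]//; case: p {D1 ql}.
Qed.

Lemma DnE_double m k :
  2 * (qA * qB) * Pr k.+3 (DnE true m) <= Pr k.+4.+1 (DnE true m.+2).
Proof.
have s1 : 2 * (Pr k.+3 (DnE true m) * qA) <= Pr k.+4 (DnE false m.+1).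
  apply: (@le_trans _ _ (Pr k.+4 (fun t => node (fun=> True) (DnE true m) (QL false) t \/
      node (fun=> True) (QL false) (DnE true m) t))).
    rewrite node_sym_ge; last by move=> t _; exact: (@DnE_QL_disj false).
    by rewrite probT ?card_bool // mul1r ler_wpM2l ?ler_wpM2l ?Pr_ge0 ?(QL_ge false).
  apply: Pr_le => -[//|b l r] _ [] [_ h1 h2].
    exact: (@DnE_step false m false).
  exact: (@DnE_step false m true).
have s2 : 2 * (1 / 2 * (Pr k.+4 (DnE false m.+1) * qB)) <= Pr k.+4.+1 (DnE true m.+2).
  apply: (@le_trans _ _ (Pr k.+4.+1 (fun t => node (eq^~ false) (DnE false m.+1) (QL true) t \/
      node (eq^~ false) (QL true) (DnE false m.+1) t))).
    rewrite node_sym_ge; last by move=> t _; exact: (@DnE_QL_disj true).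
    by rewrite prob_bool !ler_wpM2l ?Pr_ge0 ?(QL_ge true) //; lra.
  apply: Pr_le => -[//|b l r] _ [] [-> h1 h2].
    exact: (@DnE_step true m.+1 false).
  exact: (@DnE_step true m.+1 true).
have := ler_wpM2r (ltW qB_gt0) s1; lra.
Qed.

Lemma DnE_ge j k : (j.*2 + 3 <= k)%N -> 2 / 5 * front_rate ^+ j <= Pr k (DnE true j.*2).
Proof.
elim: j k => [|j IH] k le.
  rewrite expr0 mulr1; have [_ _ _ h _] := lower_Q R k.
  apply: (le_trans h); rewrite -Pr_neg; apply: Pr_le => t _ [? ?].
  exact: DnE0_A.
have [i Ei] : exists i, k = i.+4.+1 by exists (k - 5)%N; lia.
subst k; rewrite doubleS; apply: le_trans (DnE_double _ _).
rewrite [front_rate ^+ _]exprS mulrCA -/front_rate ler_wpM2l ?front_rate_ge0 // IH //; lia.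
Qed.

(** The factor 1/10 = (1/2) (1/2) (2/5) is for the initial state of [x] and for the subtrees [A] and
    [B] of [block_unstable]; the others start the upward and the downward leg. *)
Definition block_const : R := 1 / 10 * ((1 / 10) ^+ 7 * (2 / 5)).

Lemma Blk_ge j (n := (j.*2 + 6)%N) :
  block_const * front_rate ^+ n <= Pr (n + 6) (Blk (n.+1 + n)).
Proof.
have up : (1 / 10) ^+ 7 * front_rate ^+ j <= Pr (n + 3) (UpE n) by apply: UpE_ge; rewrite /n; lia.
have dn : 2 / 5 * front_rate ^+ (j + 3) <= Pr (n + 3) (DnE true n).
  have -> : n = (j + 3).*2 by rewrite /n; lia.
  by apply: DnE_ge; lia.
have [_ _ _ _ hS] := lower_Q R (n + 4); have [_ _ _ hA _] := lower_Q R (n + 5).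
have k0 := front_rate_ge0.
have k1 : front_rate <= 1 by rewrite /front_rate /qA /qB; lra.
apply: (@le_trans _ _ (Pr (n + 6) (node (fun=> True)
   (node (eq^~ true) (node (fun=> True) (UpE n) (DnE true n)) SB)
   (fun t => root t = true /\ SA t)))).
  have -> : (n + 6 = (n + 3).+3)%N by lia.
  rewrite Pr_nodeT Pr_nodeb Pr_nodeT.
  have -> : ((n + 3).+1 = n + 4)%N by lia.
  have -> : ((n + 4).+1 = n + 5)%N by lia.
  have ud : (1 / 10) ^+ 7 * front_rate ^+ j * (2 / 5 * front_rate ^+ (j + 3)) <=
      Pr (n + 3) (UpE n) * Pr (n + 3) (DnE true n).
    by rewrite ler_pM // mulr_ge0 ?exprn_ge0 //; lra.
  have kn : front_rate ^+ n <= front_rate ^+ j * front_rate ^+ (j + 3).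
    by rewrite -exprD; apply: ler_wiXn2l; rewrite // /n; lia.
  set U := Pr (n + 3) (UpE n) * _ in ud *.
  set e := (1 / 10) ^+ 7 in ud *; set X := front_rate ^+ n in kn *.
  have e0 : 0 <= e by rewrite exprn_ge0 //; lra.
  have X0 : 0 <= X by rewrite exprn_ge0.
  have uX : e * (2 / 5) * X <= U.
    apply: le_trans ud; rewrite [Y in _ <= Y]mulrACA ler_wpM2l //.
    by rewrite mulr_ge0 //; lra.
  have U0 : 0 <= U by rewrite mulr_ge0 ?Pr_ge0.
  have uS : U * (1 / 2) <= U * Pr (n + 4) SB by rewrite ler_wpM2l.
  apply: (@le_trans _ _ ((1 / 2 * (U * Pr (n + 4) SB)) * (2 / 5))); last first.
    apply: ler_wpM2l => //; apply: mulr_ge0; first by lra.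
    by apply: mulr_ge0 => //; exact: Pr_ge0.
  rewrite /block_const -/e; lra.
apply: Pr_le => -[//|b0 x B] _ [_ + [rB SAB]].
case: x => // b1 u A [-> + SBA]; case: u => // b2 L Rr [_ up' dn'].
by apply: (block_unstable erefl) => //; rewrite /n; lia.
Qed.

Fixpoint NoBlk (T j : nat) (t : tr) : Prop :=
  if j is i.+1 then node (fun=> True) (NoBlk T i) (NoBlk T i) t else ~ Blk T t.

Lemma Pr_NoBlk T j k : Pr (j + k) (NoBlk T j) = (1 - Pr k (Blk T)) ^+ (2 ^ j).
Proof.
elim: j => [|j IH]; first by rewrite expn0 expr1 add0n /= PrC.
by rewrite addSn /= Pr_nodeT IH expnS mul2n -addnn exprD.
Qed.

Lemma NoBlk_unstable T j k t : perf (j + k) t -> ~ NoBlk T j t -> Blk T t.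
Proof.
elim: j t => [|j IH] t; first by move=> _ /contrapT.
case: t => [//|b l r] [pl pr] nb z; rewrite !state_Nd => -[_ El Er].
apply: nb; split=> //; apply: contrapT => h; first exact: (IH l pl h _ El).
exact: (IH r pr h _ Er).
Qed.

(** A substitute for the exponential bound: N independent blocks all fail with probability at most 1
    / (1 + N p). *)
Lemma expr_1B_le (p : R) N : 0 <= p <= 1 -> (1 - p) ^+ N * (1 + N%:R * p) <= 1.
Proof.
move=> /andP[p0 p1]; elim: N => [|N IH]; first by rewrite expr0 mul0r addr0 mul1r.
rewrite exprS -natr1; set X := (1 - p) ^+ N in IH *.
have X0 : 0 <= X by rewrite exprn_ge0 // subr_ge0.
have N0 : 0 <= N%:R :> R by [].
apply: le_trans IH; rewrite mulrAC [_ * X]mulrC ler_wpM2l //.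
by have := mulr_ge0 N0 (mulr_ge0 p0 p0); have := mulr_ge0 p0 p0; lra.
Qed.

(** Only the 2^i disjoint blocks inside the first subtree of the root are used. *)
Lemma prob_stable j i (n := (j.*2 + 6)%N) (h := (i + (n + 6))%N) :
  prob R (fun x : WPT h => iter (n.*2).-1 wstep (wemb x) = iter (n.*2).+1 wstep (wemb x))
  * (1 + (2 ^ i)%:R * (block_const * front_rate ^+ n)) <= 1.
Proof.
set p := Pr (n + 6) (Blk (n.+1 + n)).
have pB : block_const * front_rate ^+ n <= p by exact: Blk_ge.
have p01 : 0 <= p <= 1 by rewrite Pr_ge0 Pr_le1.
apply: le_trans (expr_1B_le (2 ^ i) p01); apply: ler_pM.
- exact: prob_ge0.
- by rewrite addr_ge0 // mulr_ge0 ?ler0n // mulr_ge0 ?exprn_ge0 ?front_rate_ge0 // /block_const !mulr_ge0 ?exprn_ge0 //; lra.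
- rewrite -Pr_NoBlk -/h.
  have -> : Pr h (NoBlk (n.+1 + n) i) = prob R (fun x : WPT h => NoBlk (n.+1 + n) i (emb x.2.1)).
    rewrite (prob_snd R (fun y : PT h * (PT h * PT h) => NoBlk (n.+1 + n) i (emb y.1))) ?card_bool //.
    by rewrite (prob_fst R (fun y : PT h => NoBlk (n.+1 + n) i (emb y))) ?card_prod ?muln_gt0 ?card_PT_gt0.
  apply: prob_le => x; rewrite !iter_wstep => -[_ E _ _].
  apply: contrapT => nb; have := NoBlk_unstable (emb_perf x.2.1) nb.
  move=> /(_ (wout (wemb x))); have -> : (n.+1 + n = n.*2.+1)%N by lia.
  by apply.
- by rewrite lerD2l ler_wpM2l.
Qed.

End Blocks.

(** * Perfect binary trees as graphs *)

Section NonBacktracking.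

Variable V : eqType.

Fixpoint nonback (s : seq V) : bool :=
  if s is x :: s1 then
    (if s1 is _ :: z :: _ then x != z else true) && nonback s1
  else true.

Lemma nonback_catr s1 s2 : nonback (s1 ++ s2) -> nonback s2.
Proof. by elim: s1 => //= x s1 IH /andP[_ /IH]. Qed.

Lemma nonback_catl s1 s2 : nonback (s1 ++ s2) -> nonback s1.
Proof.
elim: s1 => //= x s1 IH /andP[H /IH ->]; rewrite andbT.
by case: s1 H {IH} => [|y [|z s1]].
Qed.

Lemma nonback_glue s a x t : nonback (s ++ [:: a; x]) -> nonback (a :: x :: t) -> nonback (s ++ a :: x :: t).
Proof.
elim: s => [//|y s IH] /= /andP[H /IH{}IH] /IH ->; rewrite andbT.
by case: s H {IH} => [|? [|? ?]].
Qed.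

Lemma nonback_rev s : nonback s -> nonback (rev s).
Proof.
elim: s => [//|x [|y [|z s]] IH] // /andP[xz /IH].
rewrite !rev_cons -!cats1 -!catA /= => H.
by apply: nonback_glue => //=; rewrite eq_sym xz.
Qed.

Lemma uniq_nonback s : uniq s -> nonback s.
Proof.
elim: s => //= x s IH /andP[xs /IH ->]; rewrite andbT.
by case: s xs {IH} => [|y [|z s]] //; rewrite !inE !negb_or => /and3P[].
Qed.

End NonBacktracking.

Section Tree.

Variables (V : finType) (e : rel V).
Hypotheses (sym : symmetric e) (irr : irreflexive e) (acyc : acyclic e).

Definition npath (x : V) (s : seq V) : bool := path e x s && nonback (x :: s).

(** A repeated last vertex closes a loop, a backtrack or a cycle of length at least 3. *)
Lemma npath_uniq x s : npath x s -> uniq (x :: s).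
Proof.
elim/last_ind: s => // s w IH /andP[]; rewrite rcons_path => /andP[ps ew] nbs.
have nbs' : nonback (x :: s) by move: nbs; rewrite -cats1 -cat_cons => /nonback_catl.
have us : uniq (x :: s) by apply: IH; rewrite /npath ps.
rewrite -rcons_cons rcons_uniq us andbT; apply/negP => wxs.
case/splitPl: wxs ps ew us nbs nbs' IH => p1 p2 lw ps ew us nbs _ _.
have pw : path e w p2 by move: ps; rewrite cat_path lw => /andP[].
have lw2 : last x (p1 ++ p2) = last w p2 by rewrite last_cat lw.
rewrite lw2 in ew.
have uw : uniq (w :: p2).
  move: us; rewrite -cat_cons cat_uniq => /and3P[_ H u2]; rewrite /= u2 andbT.
  apply/negP => wp; case/negP: H; apply/hasP; exists w => //.
  by rewrite -lw; exact: mem_last.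
case: p2 pw ew uw ps lw2 nbs us => [|y [|z p2]] pw ew uw ps lw2 nbs us.
- by move: ew; rewrite /= irr.
- move: nbs; rewrite -cats1 -catA -cat_cons lastI lw -cats1 -catA.
  by move=> /nonback_catr /=; rewrite eqxx.
- apply: (acyc (c := [:: w, y, z & p2])) => //.
  rewrite /ucycle /ucycleb uw andbT.
  by rewrite -[cycle _ _]/(path e w (rcons [:: y, z & p2] w)) rcons_path pw.
Qed.

Lemma npath_closed x s : npath x s -> last x s = x -> s = [::].
Proof.
move=> /npath_uniq /= /andP[xs _]; case/lastP: s xs => // s y.
by rewrite mem_rcons inE last_rcons => /norP[/eqP xy _] yx; rewrite yx in xy.
Qed.

Lemma npath_cons x a s : npath x (a :: s) -> npath a s.
Proof. by move=> /andP[/= /andP[_ ps] /andP[_ nbs]]; rewrite /npath ps. Qed.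

Lemma npath_rev_cat x a s b t : npath x (a :: s) -> npath x (b :: t) -> a != b ->
  npath (last x (a :: s)) (rev (belast x (a :: s)) ++ b :: t).
Proof.
move=> /andP[p1 n1] /andP[p2 n2] ab; rewrite /npath cat_path; apply/andP; split.
  rewrite rev_path (eq_path (e' := e)); last by move=> ? ?; rewrite sym.
  rewrite p1 /= rev_cons last_rcons; exact: p2.
have -> : last x (a :: s) :: rev (belast x (a :: s)) ++ b :: t =
    rev s ++ [:: a, x, b & t].
  rewrite -cat_cons -rev_rcons -lastI !rev_cons -!cats1 -!catA //.
apply: nonback_glue; last by move: n2; rewrite /= ab.
by have := nonback_rev n1; rewrite !rev_cons -!cats1 -catA.
Qed.

(** Two paths that part at the first step would join to a closed non-backtracking path. *)
Lemma npath_inj x s t : npath x s -> npath x t -> last x s = last x t -> s = t.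
Proof.
elim: s x t => [|a s IH] x [|b t] ns nt E //.
- by rewrite (npath_closed nt (esym E)).
- by rewrite (npath_closed ns E).
case: (eqVneq a b) => [ab|ab].
  by subst b; congr cons; apply: (IH a) => //; [exact: npath_cons ns|exact: npath_cons nt].
have := npath_closed (npath_rev_cat ns nt ab).
rewrite last_cat /= => /(_ (esym E)) => H.
by move: (congr1 size H); rewrite size_cat addnS.
Qed.

Lemma walk_intro x s : path e x s -> walk e (size s) x (last x s).
Proof. by move=> ps; apply/existsP; exists (in_tuple s); rewrite ps /=. Qed.

Lemma dist_walk x y n : walk e n x y -> dist e x y <= n.
Proof.
move=> w; rewrite leqNgt; apply/negP => lt.
have nV : n < #|V|.
  apply: leq_trans lt _.
  by have := find_size (fun n => walk e n x y) (iota 0 #|V|); rewrite size_iota.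
by have := before_find 0 lt; rewrite nth_iota // add0n w.
Qed.

Lemma walk_npath x y n : walk e n x y ->
  exists s, [/\ npath x s, last x s = y & size s <= n].
Proof.
move=> /existsP[p /andP[pp /eqP lp]]; move: lp; case/shortenP: pp => s ps us ss lp.
exists s; split => //; first by rewrite /npath ps uniq_nonback.
by rewrite -(size_tuple p); apply: uniq_leq_size => //; case/andP: us.
Qed.

Lemma dist_npath x s : npath x s -> dist e x (last x s) = size s.
Proof.
move=> ns; have ps := ns; case/andP: ps => ps _.
have le := dist_walk (walk_intro ps).
have lt : size s < #|V|.
  by have := card_uniqP (npath_uniq ns) => /= <-; exact: max_card.
apply/eqP; rewrite eqn_leq le /=.
have hs : has (fun n => walk e n x (last x s)) (iota 0 #|V|).
  by apply/hasP; exists (size s); rewrite ?mem_iota //; exact: walk_intro.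
have := nth_find 0 hs; rewrite nth_iota; last by have := hs; rewrite has_find size_iota.
rewrite add0n => /walk_npath[t [nt lt' st]].
by have E := npath_inj ns nt (esym lt'); rewrite {1}E; exact: st.
Qed.

Lemma npath_rcons x s v y : npath x (rcons s v) -> e v y -> y != last x s ->
  npath x (rcons (rcons s v) y).
Proof.
move=> /andP[ps ns] ev yl; apply/andP; split; first by rewrite rcons_path ps last_rcons.
have -> : x :: rcons (rcons s v) y = belast x s ++ [:: last x s; v; y].
  by rewrite -!rcons_cons lastI -!cats1 -!catA.
apply: nonback_glue; last by rewrite /= eq_sym yl.
by move: ns; rewrite -rcons_cons lastI -!cats1 -catA.
Qed.

Definition kids (p v : V) : seq V := enum [pred y | e v y && (y != p)].
(** The default [v] is not reached when [v] has degree 3 and [p] is one of its neighbours. *)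
Definition kid0 p v := nth v (kids p v) 0.
Definition kid1 p v := nth v (kids p v) 1.

Lemma kidsP p v : degree e v = 3 -> e p v ->
  [/\ kids p v = [:: kid0 p v; kid1 p v], kid0 p v != kid1 p v &
      forall y, e v y && (y != p) = (y == kid0 p v) || (y == kid1 p v)].
Proof.
move=> d3 epv.
have sz : size (kids p v) = 2.
  have : #|[set y | e v y]| = 3 by [].
  rewrite (cardD1 p) inE sym epv /kids -cardE => -[] <-; apply: eq_card => y.
  by rewrite !inE andbC.
have E : kids p v = [:: kid0 p v; kid1 p v].
  by rewrite /kid0 /kid1; case: (kids p v) sz => [|? [|? [|]]].
split=> //.
- have : uniq (kids p v) by exact: enum_uniq.
  by rewrite E /= inE andbT.
- move=> y; have : (y \in kids p v) = (e v y && (y != p)) by rewrite mem_enum inE.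
  by rewrite {1}E !inE.
Qed.

Fixpoint descs (k : nat) (p v : V) : seq V :=
  v :: if k is j.+1 then descs j v (kid0 p v) ++ descs j v (kid1 p v) else [::].

Fixpoint has_height (k : nat) (p v : V) : Prop :=
  e p v /\
  if k is j.+1 then [/\ degree e v = 3, has_height j v (kid0 p v) & has_height j v (kid1 p v)]
  else degree e v = 1.

Lemma leaf_nbr p v y : degree e v = 1 -> e p v -> e v y -> y = p.
Proof.
move=> /eqP/cards1P[z Ez] epv evy.
have : p \in [set y | e v y] by rewrite inE sym.
have : y \in [set y | e v y] by rewrite inE.
by rewrite Ez !inE => /eqP -> /eqP ->.
Qed.

Lemma descs_path k p v y : has_height k p v -> y \in descs k p v ->
  exists2 t, npath p (v :: t) & last v t = y.
Proof.
elim: k p v => [|k IH] p v.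
  by move=> [epv _]; rewrite inE => /eqP ->; exists [::]; rewrite // /npath /= epv.
move=> [epv [d3 h0 h1]]; have [_ _ kid] := kidsP d3 epv.
have ext c t : (c == kid0 p v) || (c == kid1 p v) -> npath v (c :: t) -> npath p [:: v, c & t].
  rewrite -kid => /andP[evc cp] /andP[/= pc nc].
  by rewrite /npath /= epv pc /= eq_sym cp nc.
rewrite inE mem_cat => /orP[/eqP ->|/orP[H|H]].
- by exists [::]; rewrite // /npath /= epv.
- have [t nt lt] := IH _ _ h0 H; exists (kid0 p v :: t) => //.
  by apply: ext nt; rewrite eqxx.
- have [t nt lt] := IH _ _ h1 H; exists (kid1 p v :: t) => //.
  by apply: ext nt; rewrite eqxx orbT.
Qed.

Lemma path_descs k p v t : has_height k p v -> npath p (v :: t) -> last v t \in descs k p v.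
Proof.
elim: k p v t => [|k IH] p v [|y t] //=; rewrite ?mem_head //.
  move=> [epv d1] /andP[/= /and3P[_ evy _] /andP[py _]].
  by move: py; rewrite (leaf_nbr d1 epv evy) eqxx.
move=> [epv [d3 h0 h1]] n; have [_ _ kid] := kidsP d3 epv.
have nv := npath_cons n.
have : (y == kid0 p v) || (y == kid1 p v).
  by rewrite -kid; move: n => /andP[/= /and3P[_ -> _] /andP[py _]]; rewrite eq_sym.
rewrite inE mem_cat => /orP[/eqP Ey|/eqP Ey]; subst y.
  by rewrite (IH _ _ _ h0 nv) orbT.
by rewrite (IH _ _ _ h1 nv) !orbT.
Qed.

Lemma descs_disj k v c d : has_height k v c -> has_height k v d -> c != d ->
  ~~ has (mem (descs k v c)) (descs k v d).
Proof.
move=> hc hd cd; apply/hasPn => y yd; apply/negP => yc.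
have [t nt lt] := descs_path hc yc; have [t' nt' lt'] := descs_path hd yd.
have [E _] : c :: t = d :: t' by apply: (npath_inj nt nt'); rewrite /= lt lt'.
by rewrite E eqxx in cd.
Qed.

Lemma descs_root k v c : has_height k v c -> v \notin descs k v c.
Proof.
move=> hc; apply/negP => /(descs_path hc)[t nt lt].
by have := npath_closed nt lt.
Qed.

Lemma descs_uniq k p v : has_height k p v -> uniq (descs k p v).
Proof.
elim: k p v => [//|k IH] p v [epv [d3 h0 h1]].
have [_ kid01 _] := kidsP d3 epv.
rewrite /= mem_cat negb_or !descs_root //= cat_uniq !IH //= andbT.
exact: descs_disj.
Qed.

(** * Levels of a perfect tree *)

Definition nbrs (r : V) : seq V := enum [pred y | e r y].

Section Rooted.

Variable r : V.
Hypothesis conn : forall x y, connect e x y.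
Hypothesis deg : forall x, degree e x = 1 \/ degree e x = 3.
Hypothesis lvl : forall x y, degree e x = 1 -> degree e y = 1 -> dist e r x = dist e r y.

Lemma npath_exists x y : exists2 s, npath x s & last x s = y.
Proof.
have /connectP[p pp ->] := conn x y; case/shortenP: pp => s ps us _.
by exists s; rewrite // /npath ps uniq_nonback.
Qed.

Lemma npath_extend s : npath r s -> s != [::] ->
  exists t, npath r (s ++ t) /\ degree e (last r (s ++ t)) = 1.
Proof.
move: {2}(#|V| - size s)%N (leqnn (#|V| - size s)) => n.
elim: n s => [|n IH] s le ns s0.
  have := card_uniqP (npath_uniq ns) => /= E.
  by have := max_card (mem (r :: s)); rewrite E; lia.
case: (deg (last r s)) => [d1|d3]; first by exists [::]; rewrite cats0.
case/lastP: s s0 ns d3 le => // s v _ ns; rewrite last_rcons => d3 le.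
have ev : e (last r s) v by move: ns => /andP[]; rewrite rcons_path => /andP[].
have [_ _ kid] := kidsP d3 ev.
have := kid (kid0 (last r s) v); rewrite eqxx => /andP[e0 n0].
have ns' := npath_rcons ns e0 n0.
have [||t [nt dt]] := IH _ _ ns'; [by rewrite size_rcons; lia|by case: (s)|].
by exists (kid0 (last r s) v :: t); rewrite -cat_rcons.
Qed.

Lemma root_nbr : exists y, e r y.
Proof.
have : (0 < #|[set y | e r y]|)%N.
  by rewrite -/(degree e r); case: (deg r) => ->.
by move=> /card_gt0P[y]; rewrite inE; exists y.
Qed.

(** An inner vertex at the depth of the leaves could be prolonged to a deeper leaf. The number [h]
    is the height of the three subtrees at the root, hence the shift by 1. *)
Lemma depth_exists : exists h, [/\ degree e r = 3,
  forall s, npath r s -> degree e (last r s) = 1 -> size s = h.+1 &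
  forall s, npath r s -> size s = h.+1 -> degree e (last r s) = 1].
Proof.
have [y ery] := root_nbr.
have ny : npath r [:: y] by rewrite /npath /= ery.
have [t [nt dt]] := npath_extend ny isT.
exists (size t); have dist_t := dist_npath nt.
have H s : npath r s -> degree e (last r s) = 1 -> size s = (size t).+1.
  by move=> ns ds; rewrite -(dist_npath ns) (lvl ds dt) dist_t.
split=> //.
- case: (deg r) => // d1; have := H [::] isT d1.
  by [].
- move=> s ns ss; have s0 : s != [::] by case: (s) ss.
  case: (deg (last r s)) => // d3.
  case/lastP: s s0 ns d3 ss => // s v _ ns; rewrite last_rcons => d3 ss.
  have ev : e (last r s) v by move: ns => /andP[]; rewrite rcons_path => /andP[].
  have [_ _ kid] := kidsP d3 ev.
  have := kid (kid0 (last r s) v); rewrite eqxx => /andP[e0 n0].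
  have ns' := npath_rcons ns e0 n0.
  have [|t' [nt' dt']] := npath_extend ns'; first by case: (s).
  by have := H _ nt' dt'; rewrite size_cat size_rcons ss; lia.
Qed.

Variable h : nat.
Hypothesis root3 : degree e r = 3.
Hypothesis leaf_depth : forall s, npath r s -> degree e (last r s) = 1 -> size s = h.+1.
Hypothesis depth_leaf : forall s, npath r s -> size s = h.+1 -> degree e (last r s) = 1.

Lemma npath_height k s v : npath r (rcons s v) -> (size s + k = h)%N -> has_height k (last r s) v.
Proof.
elim: k s v => [|k IH] s v ns ss.
  split; first by move: ns => /andP[]; rewrite rcons_path => /andP[].
  by have := depth_leaf ns; rewrite last_rcons size_rcons; apply; lia.
have ev : e (last r s) v by move: ns => /andP[]; rewrite rcons_path => /andP[].
have d3 : degree e v = 3.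
  case: (deg v) => // d1; have := leaf_depth ns; rewrite last_rcons size_rcons => /(_ d1).
  by lia.
have [_ _ kid] := kidsP d3 ev.
have hk y : (y == kid0 (last r s) v) || (y == kid1 (last r s) v) -> has_height k v y.
  rewrite -kid => /andP[e0 n0]; have := IH _ _ (npath_rcons ns e0 n0).
  by rewrite last_rcons; apply; rewrite size_rcons; lia.
by split=> //; split=> //; apply: hk; rewrite eqxx ?orbT.
Qed.

Let n0 := nth r (nbrs r) 0.
Let n1 := nth r (nbrs r) 1.
Let n2 := nth r (nbrs r) 2.

Lemma nbrsE : nbrs r = [:: n0; n1; n2].
Proof.
have sz : size (nbrs r) = 3 by rewrite -cardE -root3; apply: eq_card => y; rewrite !inE.
by rewrite /n0 /n1 /n2; case: (nbrs r) sz => [|? [|? [|? [|]]]].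
Qed.

Lemma nbrs_uniq : uniq [:: n0; n1; n2].
Proof. by rewrite -nbrsE; exact: enum_uniq. Qed.

Lemma nbr_in y : e r y = (y \in [:: n0; n1; n2]).
Proof. by rewrite -nbrsE mem_enum inE. Qed.

Lemma nbr_height y : e r y -> has_height h r y.
Proof. by move=> ery; apply: (npath_height (s := [::])); rewrite // /npath /= ery. Qed.

Lemma er0 : e r n0. Proof. by rewrite nbr_in inE eqxx. Qed.
Lemma er1 : e r n1. Proof. by rewrite nbr_in !inE eqxx orbT. Qed.
Lemma er2 : e r n2. Proof. by rewrite nbr_in !inE eqxx !orbT. Qed.

Definition allV : seq V := r :: descs h r n0 ++ (descs h r n1 ++ descs h r n2).

Lemma allV_uniq : uniq allV.
Proof.
have [[h0 h1] h2] := (nbr_height er0, nbr_height er1, nbr_height er2).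
have := nbrs_uniq; rewrite /= !inE negb_or andbT => /andP[/andP[n01 n02] n12].
rewrite /allV /= !mem_cat !negb_or !descs_root //= !cat_uniq !descs_uniq //= has_cat negb_or.
by rewrite !descs_disj.
Qed.

Lemma allV_mem y : y \in allV.
Proof.
have [[|a s] ns ly] := npath_exists r y; first by rewrite -ly mem_head.
have era : e r a by case/andP: ns => /= /andP[].
have ya : y \in descs h r a by rewrite -ly; exact: path_descs (nbr_height era) ns.
rewrite /allV inE !mem_cat; move: era; rewrite nbr_in !inE.
by move=> /or3P[] /eqP Ea; rewrite -Ea ya ?orbT.
Qed.

Lemma npath_size s : npath r s -> (size s <= h.+1)%N.
Proof.
move=> ns; case: (eqVneq s [::]) => [->//|s0].
have [t [nt dt]] := npath_extend ns s0.
by rewrite -(leaf_depth nt dt) size_cat leq_addr.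
Qed.

Lemma diameterE : diameter e = h.+1.*2.
Proof.
apply/eqP; rewrite eqn_leq; apply/andP; split.
  apply/bigmax_leqP => x _; apply/bigmax_leqP => y _.
  have [s ns lx] := npath_exists r x; have [t nt ly] := npath_exists r y.
  have ps : path e x (rev (belast r s) ++ t).
    rewrite cat_path -{1}lx rev_path (eq_path (e' := e)); last by move=> ? ?; rewrite sym.
    case/andP: ns => -> _ /=.
    have -> : last x (rev (belast r s)) = r.
      by case: s lx => [|a s] lx //=; rewrite rev_cons last_rcons.
    by case/andP: nt.
  have : last x (rev (belast r s) ++ t) = y.
    rewrite last_cat; have -> // : last x (rev (belast r s)) = r.
    by case: s {ps ns} lx => [|a s] lx //=; rewrite rev_cons last_rcons.
  move=> <-; apply: leq_trans (dist_walk (walk_intro ps)) _.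
  rewrite size_cat size_rev size_belast -addnn.
  by apply: leq_add; exact: npath_size.
have m0 : npath r [:: n0] by rewrite /npath /= er0.
have m1 : npath r [:: n1] by rewrite /npath /= er1.
have [t0 [nt0 d0]] := npath_extend m0 isT; have [t1 [nt1 d1]] := npath_extend m1 isT.
have n01 : n0 != n1 by have := nbrs_uniq; rewrite /= !inE negb_or => /andP[/andP[]].
have nn := npath_rev_cat nt0 nt1 n01.
have := dist_npath nn; set y := last _ (_ ++ _) => dd.
apply: leq_trans (leq_bigmax (last r (n0 :: t0))).
apply: leq_trans (leq_bigmax y).
rewrite dd size_cat size_rev size_belast.
by rewrite -[size (n0 :: t0)]/(size ([:: n0] ++ t0)) -[size (n1 :: t1)]/(size ([:: n1] ++ t1))
  !leaf_depth // addnn.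
Qed.

(** * Configurations of the graph as random trees *)

Fixpoint subconfig (k : nat) (p v : V) (x : {ffun V -> bool}) : PT k :=
  match k with
  | 0 => x v
  | j.+1 => (x v, (subconfig j v (kid0 p v) x, subconfig j v (kid1 p v) x))
  end.

Definition model (x : {ffun V -> bool}) : WPT h :=
  (x r, (subconfig h r n0 x, (subconfig h r n1 x, subconfig h r n2 x))).

Lemma subconfig_inj k p v x x' : subconfig k p v x = subconfig k p v x' ->
  forall y, y \in descs k p v -> x y = x' y.
Proof.
elim: k p v => [|k IH] p v /=; first by move=> E y; rewrite inE => /eqP ->.
case=> Ev E0 E1 y; rewrite inE mem_cat => /or3P[/eqP ->//|/(IH _ _ E0)//|/(IH _ _ E1)//].
Qed.

Lemma model_inj : injective model.
Proof.
move=> x x' [Er E0 E1 E2]; apply/ffunP => y; move: (allV_mem y).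
rewrite /allV inE !mem_cat => /or4P[/eqP ->//| | |].
- exact: subconfig_inj E0 y.
- exact: subconfig_inj E1 y.
- exact: subconfig_inj E2 y.
Qed.

Lemma card_PT k p v : #|PT k| = 2 ^ size (descs k p v).
Proof.
elim: k p v => [|k IH] p v; first by rewrite /= card_bool.
by rewrite /= !card_prod card_bool expnS size_cat expnD -!IH.
Qed.

(** [allV] lists every vertex, which gives injectivity, and each only once, which gives equal
    cardinalities. The uniform measure thus becomes a product over the three subtrees and the
    root. *)
Lemma model_bij : bijective model.
Proof.
apply: inj_card_bij model_inj _.
rewrite card_ffun card_bool /WPT !card_prod card_bool.
have -> : (2 * (#|PT h| * (#|PT h| * #|PT h|)) = 2 ^ size allV)%N.
  by rewrite /allV /= expnS !size_cat !expnD -!card_PT.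
rewrite leq_exp2l //.
by have := card_uniqP allV_uniq => <-; exact: max_card.
Qed.

Definition bstep (x : {ffun V -> bool}) : {ffun V -> bool} :=
  [ffun v => (0 < \sum_(j | e v j) spins x j)%R].

Lemma spin_sum p v x : degree e v = 3 -> e p v ->
  (\sum_(j | e v j) spins x j = spins x p + spins x (kid0 p v) + spins x (kid1 p v))%R.
Proof.
move=> d3 epv; have [E _ _] := kidsP d3 epv.
rewrite (bigD1 p) /=; last by rewrite sym.
have -> : (\sum_(j | e v j && (j != p)) spins x j = \sum_(j <- kids p v) spins x j)%R.
  by rewrite big_enum; apply: eq_bigl => j; rewrite inE.
by rewrite E !big_cons big_nil addr0 addrA.
Qed.

Lemma spin_sum_leaf p v x : degree e v = 1 -> e p v ->
  (\sum_(j | e v j) spins x j = spins x p)%R.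
Proof.
move=> d1 epv; rewrite (bigD1 p) /=; last by rewrite sym.
rewrite big1 ?addr0 // => j /andP[evj jp].
by move: jp; rewrite (leaf_nbr d1 epv evj) eqxx.
Qed.

Lemma spin_sum_root x :
  (\sum_(j | e r j) spins x j = spins x n0 + spins x n1 + spins x n2)%R.
Proof.
have -> : (\sum_(j | e r j) spins x j = \sum_(j <- nbrs r) spins x j)%R.
  by rewrite big_enum; apply: eq_bigl => j; rewrite inE.
by rewrite nbrsE !big_cons big_nil addr0 addrA.
Qed.

Lemma spins_gt0 (x : {ffun V -> bool}) a b c :
  (0 < spins x a + spins x b + spins x c)%R = maj (x a) (x b) (x c).
Proof. by rewrite /spins !ffunE; case: (x a); case: (x b); case: (x c). Qed.

Lemma bstep_subconfig k p v x : has_height k p v ->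
  emb (subconfig k p v (bstep x)) = step (emb (subconfig k p v x)) (x p).
Proof.
elim: k p v => [|k IH] p v.
  move=> [epv d1] /=; rewrite ffunE (spin_sum_leaf x d1 epv) /spins ffunE.
  by case: (x p).
move=> [epv [d3 h0 h1]] /=; rewrite !IH // ffunE (spin_sum x d3 epv) spins_gt0.
by congr (Nd (maj _ _ _) _ _); case: (k).
Qed.

Lemma root_subconfig k p v x : root (emb (subconfig k p v x)) = x v.
Proof. by case: k. Qed.

Lemma model_step x : wemb (model (bstep x)) = wstep (wemb (model x)).
Proof.
rewrite /wemb /wstep /= !bstep_subconfig ?root_subconfig; try exact: nbr_height er0.
- by rewrite ffunE spin_sum_root spins_gt0.
- exact: nbr_height er2.
- exact: nbr_height er1.
Qed.

Lemma model_iter x n : wemb (model (iter n bstep x)) = iter n wstep (wemb (model x)).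
Proof. by elim: n => //= n <-; rewrite model_step. Qed.

Lemma emb_inj k : injective (@emb k).
Proof.
elim: k => [|k IH] /= x y; first by case.
by case: x y => [b [l m]] [b' [l' m']] /= [-> /IH -> /IH ->].
Qed.

Lemma wemb_inj : injective (@wemb h).
Proof.
by move=> [b [x [y z]]] [b' [x' [y' z']]] [/= -> /emb_inj -> /emb_inj -> /emb_inj ->].
Qed.

Lemma majority_stepE x : majority_step e (spins x) = spins (bstep x).
Proof.
apply/ffunP => v; rewrite !ffunE.
(* Degrees 1 and 3 exclude ties, so the sign is never 0. *)
have key : (\sum_(j | e v j) spins x j != 0)%R.
  have [y eyv] : exists y, e y v.
    have : (0 < #|[set y | e v y]|)%N by rewrite -/(degree e v); case: (deg v) => ->.
    by move=> /card_gt0P[y]; rewrite inE sym; exists y.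
  case: (deg v) => [d1|d3].
    by rewrite (spin_sum_leaf x d1 eyv) ffunE; case: (x y).
  by rewrite (spin_sum x d3 eyv) !ffunE; case: (x y); case: (x _); case: (x _).
by case: (ltgtP (\sum_(j | e v j) spins x j) 0)%R key => [lt|gt|->] // _;
  [rewrite ltr0_sg|rewrite gtr0_sg].
Qed.

Lemma majorityE x n : majority e (spins x) n = spins (iter n bstep x).
Proof. by rewrite /majority; elim: n => //= n ->; rewrite majority_stepE. Qed.

Lemma spins_inj : injective (@spins V).
Proof.
move=> x y /ffunP E; apply/ffunP => i; have := E i; rewrite !ffunE.
by case: (x i); case: (y i).
Qed.

Lemma stabilisedE x t : stabilised e (spins x) t <->
  iter t wstep (wemb (model x)) = iter t.+2 wstep (wemb (model x)).
Proof.
rewrite -!model_iter; split=> [/forallP H|/wemb_inj/model_inj E].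
  congr (wemb (model _)); apply: spins_inj; rewrite -!majorityE.
  by apply/ffunP => i; apply/esym/eqP.
by apply/forallP => i; rewrite !majorityE -E.
Qed.

End Rooted.

End Tree.

Lemma perfect_binary_tree_model (V : finType) (e : rel V) (r : V) :
  perfect_binary_tree e r ->
  exists h, diameter e = h.+1.*2 /\
  exists2 f : {ffun V -> bool} -> WPT h, bijective f &
    forall x t, stabilised e (spins x) t <->
      iter t wstep (wemb (f x)) = iter t.+2 wstep (wemb (f x)).
Proof.
move=> [[[[sym irr] conn acyc] kary] lvl].
have deg x : degree e x = 1 \/ degree e x = 3.
  case: (boolP (leaf e x)) => [/eqP|/kary]; by [left|right].
have lvl' x y : degree e x = 1 -> degree e y = 1 -> dist e r x = dist e r y.
  by move=> dx dy; apply: lvl; apply/eqP.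
have [h [r3 ld dl]] := depth_exists sym irr acyc deg lvl'.
exists h; split; first exact: (diameterE sym irr acyc conn deg r3 ld).
exists (@model V e r h).
  exact: (model_bij sym irr acyc conn deg r3 ld dl).
by move=> x t; exact: (stabilisedE sym conn deg r3 ld dl).
Qed.

(** * Asymptotics *)

Local Open Scope ring_scope.

Section Asymptotics.

Variable R : realType.

Lemma bernoulli (p : R) N : 0 <= p -> 1 + N%:R * p <= (1 + p) ^+ N.
Proof.
move=> p0; elim: N => [|N IH]; first by rewrite expr0 mul0r addr0.
rewrite exprS -natr1; have N0 : 0 <= N%:R :> R by [].
have h : (1 + p) * (1 + N%:R * p) <= (1 + p) * (1 + p) ^+ N.
  by rewrite ler_wpM2l // addr_ge0.
by apply: le_trans h; have := mulr_ge0 N0 (mulr_ge0 p0 p0); lra.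
Qed.

(** If [g] were at most 2M, the product of powers would be at most (4 [chain_rate]^2)^M <=
    (19/20)^M. The excess of about M/33 in [g] costs 20 factors 19/20 per power of 2; at least M/3
    factors remain. *)
Lemma upper_rate (M g : nat) : (33 * g <= 67 * M + 33)%N ->
  (M.*2).+1%:R * (chain_rate R ^+ (M.*2) * 2 ^+ g) * (M %/ 3).+1%:R <= 12 * (40 * 40) :> R.
Proof.
move=> hg; set m := (M %/ 3)%N; pose u := (M %/ 33)%N.
pose rho : R := 19 / 20.
have rho0 : 0 <= rho by rewrite /rho; lra.
have half20 : rho ^+ 20 * 2 <= 1.
  have := @expr_1B_le R (1 / 20) 20.
  have -> : 1 - 1 / 20 = rho by rewrite /rho; lra.
  have -> : 1 + 20%:R * (1 / 20) = 2 :> R by lra.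
  by apply; apply/andP; split; lra.
have x4 : chain_rate R ^+ 2 * 4 <= rho by rewrite /chain_rate /rho; lra.
have x0 : 0 <= chain_rate R by rewrite ltW ?chain_rate_gt0.
have s1 : chain_rate R ^+ (M.*2) * 2 ^+ g <= 2 * (rho ^+ M * 2 ^+ u).
  apply: (@le_trans _ _ (chain_rate R ^+ (M.*2) * 2 ^+ (M.*2 + u.+1))).
    by rewrite ler_wpM2l ?exprn_ge0 // ler_weXn2l //; [lra|rewrite /u; lia].
  rewrite exprD exprS mulrA -mul2n !exprM -exprMn mulrCA ler_wpM2l // ler_wpM2r ?exprn_ge0 //.
  rewrite lerXn2r ?nnegrE //; last by have -> : 2 ^+ 2 = 4 :> R by lra.
  by rewrite mulr_ge0 ?exprn_ge0.
have s2 : rho ^+ M * 2 ^+ u <= rho ^+ m.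
  have -> : M = (20 * u + (M - 20 * u))%N by rewrite /u; lia.
  rewrite exprD mulrAC exprM -exprMn.
  apply: (@le_trans _ _ (1 * rho ^+ (M - 20 * u))).
    rewrite ler_wpM2r ?exprn_ge0 // exprn_ile1 // mulr_ge0 ?exprn_ge0 //.
  rewrite mul1r ler_wiXn2l //; first by rewrite /rho; lra.
  by rewrite /m /u; lia.
(* As [rho] <= [sg]^2, each of the two linear factors can be absorbed by its own power of [sg]. *)
pose sg : R := 39 / 40.
have sg0 : 0 <= sg by rewrite /sg; lra.
have rs : rho ^+ m <= sg ^+ m * sg ^+ m.
  by rewrite -exprMn lerXn2r ?nnegrE ?mulr_ge0 // /rho /sg; lra.
have sm : sg ^+ m * m.+1%:R <= 40.
  have := @expr_1B_le R (1 / 40) m.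
  have -> : 1 - 1 / 40 = sg by rewrite /sg; lra.
  have s0 : 0 <= sg ^+ m by rewrite exprn_ge0.
  move=> /(_ _)/wrap[]; first by apply/andP; split; lra.
  rewrite -[m.+1%:R]natr1; move: (sg ^+ m) (m%:R) s0 => S y s0; rewrite !mulrDr !mulr1 => H.
  have := mulr_ge0 (ler0n R 39) s0; lra.
have M6 : (M.*2).+1%:R <= 6 * m.+1%:R :> R.
  by rewrite -natrM ler_nat /m; lia.
have m0 : 0 <= m.+1%:R :> R by [].
have t0 : 0 <= sg ^+ m by rewrite exprn_ge0.
have r0 : 0 <= rho ^+ m by rewrite exprn_ge0.
have X : chain_rate R ^+ (M.*2) * 2 ^+ g <= 2 * (sg ^+ m * sg ^+ m).
  by apply: le_trans s1 _; rewrite ler_wpM2l // (le_trans s2 rs).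
have X0 : 0 <= chain_rate R ^+ (M.*2) * 2 ^+ g by rewrite mulr_ge0 ?exprn_ge0.
apply: (@le_trans _ _ ((6 * m.+1%:R) * (2 * (sg ^+ m * sg ^+ m)) * m.+1%:R)).
  by rewrite ler_wpM2r // ler_pM.
have -> : 6 * m.+1%:R * (2 * (sg ^+ m * sg ^+ m)) * m.+1%:R =
    12 * ((sg ^+ m * m.+1%:R) * (sg ^+ m * m.+1%:R)) by ring.
by rewrite ler_wpM2l // ler_pM ?mulr_ge0.
Qed.

Lemma upper_small h (M := (33 * h %/ 100)%N) : (100 <= h)%N ->
  prob R (fun x : WPT h => iter (M.*2 + 5) wstep (wemb x) <> iter (M.*2 + 5).+2 wstep (wemb x))
  * (M %/ 3).+1%:R <= 6 * (4 * 100) * (12 * (40 * 40)).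
Proof.
move=> h100; have M0 : (0 < M.*2)%N by rewrite /M; lia.
have hM : ((M.*2)./2.+2 <= h)%N by rewrite doubleK /M; lia.
have := prob_unstable R M0 (leqnn _) hM; rewrite doubleK.
set P := prob _ _ => HP.
have m0 : 0 <= (M %/ 3).+1%:R :> R by [].
apply: le_trans (ler_wpM2r m0 HP) _.
have := @upper_rate M (h - M.+2)%N; rewrite /apex_bound natrM => /(_ _)/wrap[].
  by rewrite /M; lia.
set A := (M.*2).+1%:R; set B := chain_rate R ^+ _; set G := 2 ^+ _; set m := _.+1%:R => Q.
have -> : 6 * (4%:R * A * (100 * B) * G) * m = 6 * (4 * 100) * (A * (B * G) * m) by ring.
by rewrite ler_wpM2l //; lra.
Qed.

(** With [i] close to 3n the product is close to (8 [front_rate])^n = (1 + 13/500)^n. A deficit of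
    n/100 powers of 2 is covered by 40 factors each, and more than half of the factors remain for
    linear growth. *)
Lemma lower_rate (n i : nat) : (3 * n <= i + n %/ 100 + 33)%N ->
  n%:R <= 80 * 2 ^+ 33 * (2 ^+ i * front_rate R ^+ n).
Proof.
move=> hn; pose u := (n %/ 100)%N; pose b : R := 1 + 13 / 500.
have b8 : 8 * front_rate R = b by rewrite /b /front_rate /qA /qB; lra.
have b1 : 1 <= b by rewrite /b; lra.
have b40 : 2 <= b ^+ 40.
  by apply: le_trans (bernoulli 40 (_ : 0 <= 13 / 500)); lra.
have k0 := front_rate_ge0 R.
have p0 j : 0 <= 2 ^+ j :> R by rewrite exprn_ge0.
have s1 : 2 ^+ u * b ^+ (n - 40 * u) <= b ^+ n.
  have -> : b ^+ n = b ^+ (40 * u) * b ^+ (n - 40 * u) by rewrite -exprD; congr (_ ^+ _); rewrite /u; lia.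
  rewrite ler_wpM2r ?exprn_ge0 //; first by lra.
  by rewrite exprM lerXn2r ?nnegrE //; lra.
have s2 : b ^+ n <= 2 ^+ u * (2 ^+ 33 * (2 ^+ i * front_rate R ^+ n)).
  have -> : 2 ^+ u * (2 ^+ 33 * (2 ^+ i * front_rate R ^+ n)) = 2 ^+ (u + 33 + i) * front_rate R ^+ n.
    by rewrite !exprD !mulrA.
  have e8 : 8 = 2 ^+ 3 :> R by lra.
  rewrite -b8 exprMn e8 -exprM; apply: ler_wpM2r; first by rewrite exprn_ge0.
  by rewrite ler_weXn2l //; [lra|rewrite /u; lia].
have s3 : b ^+ (n - 40 * u) <= 2 ^+ 33 * (2 ^+ i * front_rate R ^+ n).
  have u0 : 0 < 2 ^+ u :> R by rewrite exprn_gt0.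
  by have := le_trans s1 s2; rewrite ler_pM2l.
have s4 : 1 + (n - 40 * u)%:R * (13 / 500) <= b ^+ (n - 40 * u).
  by apply: bernoulli; lra.
have s5 : n%:R <= 2 * (n - 40 * u)%:R :> R.
  by rewrite -natrM ler_nat /u; lia.
have n0 : 0 <= (n - 40 * u)%:R :> R by [].
move: s3 s4 s5 n0; move: (b ^+ _) (2 ^+ i * _) ((n - 40 * u)%:R) (2 ^+ 33) => B K d P s3 s4 s5 n0.
rewrite -mulrA; lra.
Qed.

Lemma lower_small h (j := ((h + h %/ 500) %/ 8)%N) (n := (j.*2 + 6)%N) : (200 <= h)%N ->
  prob R (fun x : WPT h => iter (n.*2).-1 wstep (wemb x) = iter (n.*2).+1 wstep (wemb x))
  * (n%:R * block_const R) <= 80 * 2 ^+ 33.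
Proof.
move=> h200; pose i := (h - (n + 6))%N.
have hE : h = (i + (n + 6))%N by rewrite /i /n /j; lia.
have := prob_stable R j i; cbv zeta; rewrite -/n -hE; set P := prob _ _ => HP.
have P0 : 0 <= P by exact: prob_ge0.
have Q : n%:R <= 80 * 2 ^+ 33 * (2 ^+ i * front_rate R ^+ n).
  by apply: lower_rate; rewrite /i /n /j; lia.
have c0 : 0 <= block_const R by rewrite /block_const !mulr_ge0 ?exprn_ge0 //; lra.
rewrite natrX in HP.
move: Q HP; move: (block_const R) c0 (2 ^+ i) (front_rate R ^+ n) (2 ^+ 33) (exprn_ge0 33 (ler0n R 2)).
move=> c c0 I K p p0 Q HP.
apply: (@le_trans _ _ (P * (80 * p * (I * K) * c))).
  by rewrite !ler_wpM2l // ler_wpM2r.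
have -> : P * (80 * p * (I * K) * c) = 80 * p * (P * (I * (c * K))) by ring.
rewrite -[leRHS]mulr1 ler_wpM2l ?mulr_ge0 //; move: HP; rewrite mulrDr mulr1; lra.
Qed.

End Asymptotics.

Lemma stabilised_le (V : finType) (e : rel V) xi s t :
  (s <= t)%N -> stabilised e xi s -> stabilised e xi t.
Proof.
move=> le; rewrite -(subnK le); elim: (t - s)%N => // d IH /IH /forallP H.
rewrite addSn; apply/forallP => i; rewrite /majority /=.
have -> : majority_step e (majority_step e (iter (d + s) (majority_step e) xi)) =
    iter (d + s) (majority_step e) xi by apply/ffunP => v; apply/eqP; exact: H.
by [].
Qed.

Lemma stabilisation_time_bounds (V : finType) (e : rel V) xi s t :
  ~ stabilised e xi s -> stabilised e xi t -> (s < stabilisation_time e xi <= t)%N.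
Proof.
move=> ns st; rewrite /stabilisation_time; case: pselect => [ex|[]]; last by exists t.
case: ex_minnP => m sm H; rewrite (H t st) andbT ltnNge; apply/negP => ms.
by apply: ns; exact: stabilised_le ms sm.
Qed.

Theorem theorem2 (R : realType) :
  exists cm cp : R,
    [/\ 1 / 4 < cm, cp < 1 / 3 &
      forall eps : R, 0 < eps ->
      exists D0 : nat, forall D : nat, (D0 <= D)%N ->
      forall (V : finType) (e : rel V) (r : V),
        perfect_binary_tree e r -> diameter e = D ->
        1 - eps <
        uniform_prob R
          [set x : {ffun V -> bool} |
            cm * D%:R < (stabilisation_time e (spins x))%:R < cp * D%:R]].
Proof.
(* The bounds for the time are 2n - 1, about 0.501 h, and 2M + 5, about 0.66 h, while D = 2h + 2.
   The ratios tend to 501/2000 and 33/100, and the two constants lie strictly between these limits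
   and 1/4, 1/3. *)
exists (128 / 511), (100 / 301); split; [by lra|by lra|] => eps eps0.
pose C : R := 6 * (4 * 100) * (12 * (40 * 40)).
pose C' : R := 80 * 2 ^+ 33 / block_const R.
pose K := Num.trunc (2 * (C + C') / eps).
(* This makes M/3 and n large compared with [K], for the probabilities, and h large enough to absorb
   the roundings in [M] and [j]. *)
exists (30 * K + 4000)%N => D leD V e r pbt dia.
have [h [dh [f bf stab]]] := perfect_binary_tree_model pbt.
have {leD} leh : (10 * K + 1300 <= h)%N by move: leD; rewrite -dia dh; lia.
pose M := (33 * h %/ 100)%N; pose j := ((h + h %/ 500) %/ 8)%N; pose n := (j.*2 + 6)%N.
pose T := (M.*2 + 5)%N.
pose U (w : WPT h) := iter T wstep (wemb w) <> iter T.+2 wstep (wemb w).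
pose L (w : WPT h) := iter (n.*2).-1 wstep (wemb w) = iter (n.*2).+1 wstep (wemb w).
have c10 : 0 < block_const R by rewrite /block_const !mulr_gt0 ?exprn_gt0 //; lra.
have pU : prob R U <= C / K.+1%:R.
  have h100 : (100 <= h)%N by lia.
  have HU := upper_small R h100; rewrite -/M -/T -/U -/C in HU.
  rewrite ler_pdivlMr ?ltr0Sn //; apply: le_trans HU; apply: ler_wpM2l; first exact: prob_ge0.
  by rewrite ler_nat /M; lia.
have pL : prob R L <= C' / K.+1%:R.
  have h200 : (200 <= h)%N by lia.
  have HL := lower_small R h200; rewrite -/j -/n -/L in HL.
  rewrite ler_pdivlMr ?ltr0Sn // /C' ler_pdivlMr // -mulrA.
  apply: le_trans HL; apply: ler_wpM2l; first exact: prob_ge0.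
  by apply: ler_wpM2r; [exact: ltW|rewrite ler_nat /n /j; lia].
have CC : (C + C') / K.+1%:R < eps / 2.
  have CC0 : 0 <= 2 * (C + C') / eps.
    apply: divr_ge0 (ltW eps0); apply: mulr_ge0 => //; apply: addr_ge0.
      by rewrite /C -!natrM ler0n.
    apply: divr_ge0 (ltW c10); apply: mulr_ge0 => //; exact: exprn_ge0.
  have := truncnS_gt (2 * (C + C') / eps).
  rewrite -/K ltr_pdivrMr // ltr_pdivrMr ?ltr0Sn // => H; lra.
have PV := prob_bij R (fun w => U w \/ L w) bf.
have PUL : prob R (fun w => U w \/ L w) < eps.
  apply: le_lt_trans (probU _ _ _) _.
  apply: le_lt_trans (lerD pU pL) _; rewrite -mulrDl; apply: lt_trans CC _.
  by clear -eps0; lra.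
have V0 : (0 < #|{ffun V -> bool}|)%N by rewrite card_ffun card_bool expn_gt0.
have := probC R (fun x => U (f x) \/ L (f x)) V0; rewrite PV => PC.
apply: (@lt_le_trans _ _ (prob R (fun x => ~ (U (f x) \/ L (f x))))).
  by rewrite PC; lra.
rewrite /uniform_prob /prob ler_wpM2r ?invr_ge0 ?ler0n // ler_nat subset_leq_card //.
apply/subsetP => x; rewrite !inE => /asboolP H.
have sT : stabilised e (spins x) T.
  by apply/stab; apply: contrapT => HU; apply: H; left.
have nS : ~ stabilised e (spins x) (n.*2).-1.
  move=> /stab HL; apply: H; right; rewrite /L HL.
  by have -> : (n.*2).-1.+2 = n.*2.+1 by rewrite /n; lia.
have /andP[t1 t2] := stabilisation_time_bounds nS sT.
rewrite -dia dh; set tau := stabilisation_time _ _ in t1 t2 *.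
have a1 : (128 * (h.+1).*2 < 511 * tau)%N by move: t1; rewrite /n /j; lia.
have a2 : (301 * tau < 100 * (h.+1).*2)%N by move: t2; rewrite /T /M; lia.
move: a1 a2; rewrite -!(ltr_nat R) !natrM => a1 a2; apply/andP; split; lra.
Qed.
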